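(* Let $j,r\ge 0$ and $k\ge 1$ be integers with $j+r\le k$. Then \[ \sum_{s_1\ge\cdots\ge s_k\ge 0}\frac{q^{s_1^2+\cdots+s_k^2-s_1-\cdots-s_j+\sum_{i=k-r+1}^{k}s_i+s_k}}{(q)_{s_1-s_2}\cdots(q)_{s_{k-1}-s_k}(q^2;q^2)_{s_k}}=\sum_{f}q^{|f|}, \] where the sum on the right runs over all frequency sequences $f=(f_i)_{i\ge0}$ such that (i) $f_i+f_{i+1}\le k$ for all $i\ge0$, (ii) $f_0\le j-\max\{f_0+f_1-(k-r),0\}$, and (iii) whenever $f_i+f_{i+1}=k$ for some $i\ge0$, we have $if_i+(i+1)f_{i+1}\equiv k+r-j+1\pmod 2$. (The exponent $\sum_{i=k-r+1}^k s_i+s_k$ is the paper's $s_{k-r+1}+\cdots+s_{k-1}+2s_k$.)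
   Context: A frequency sequence is a sequence $(f_i)_{i\ge0}$ of non-negative integers with only finitely many nonzero entries; its size is $|f|=\sum_{i\ge0} i f_i$. $q$ is a complex number with $|q|<1$ (or a formal variable); $(a;q)_n=\prod_{m=0}^{n-1}(1-aq^m)$, $(a)_n=(a;q)_n$. $s_1+\cdots+s_j=\sum_{i=1}^j s_i$. *)

(* Defs.v *)
From HB Require Import structures.
From mathcomp Require Import all_boot all_order all_algebra finmap.
From mathcomp Require Import classical_sets reals complex.

Set Implicit Arguments.
Unset Strict Implicit.
Unset Printing Implicit Defensive.

Import Order.TTheory GRing.Theory Num.Theory.

Local Open Scope ring_scope.
Local Open Scope complex_scope.

(* Unconditional summability: the finite partial sums of the family [u]
   over [D] converge to [S] along the finite subsets of [D] ordered by
   inclusion. For complex-valued families this is absolute convergence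
   with sum [S]. *)
Definition has_sum (R : realType) (I : choiceType) (D : set I)
    (u : I -> R[i]) (S : R[i]) : Prop :=
  forall e : R, 0 < e ->
    exists A : {fset I}, {in A, forall i, D i} /\
      forall B : {fset I}, (A `<=` B)%fset -> {in B, forall i, D i} ->
        `| \sum_(i <- B) u i - S | < e%:C.

(* (a; q)_n *)
Definition qpoch (K : fieldType) (a q : K) (n : nat) : K :=
  \prod_(m < n) (1 - a * q ^+ m).

(* The parts of s = (s_1, ..., s_k) are numbered from 1. *)
Definition part (s : seq nat) (i : nat) : nat := nth 0%N s i.-1.

Definition weakly_decreasing (k : nat) : set (k.-tuple nat) :=
  [set s : k.-tuple nat | sorted geq s]%classic.
Arguments weakly_decreasing k : clear implicits.

(* The exponent is taken in [int] because of the subtracted terms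
   (its value is never negative). *)
Definition multisum_exponent (k j r : nat) (s : seq nat) : int :=
  \sum_(1 <= i < k.+1) (part s i)%:Z ^+ 2
  - \sum_(1 <= i < j.+1) (part s i)%:Z
  + \sum_((k - r).+1 <= i < k.+1) (part s i)%:Z
  + (part s k)%:Z.

Definition multisum_term (K : fieldType) (q : K) (k j r : nat)
    (s : seq nat) : K :=
  q ^ multisum_exponent k j r s /
  ((\prod_(1 <= i < k) qpoch q q (part s i - part s i.+1)%N) *
   qpoch (q ^+ 2) (q ^+ 2) (part s k)).

Definition frequency_sequence := {fsfun nat -> nat with 0%N}.

Definition freq_size (f : frequency_sequence) : nat :=
  (\sum_(i <- finsupp f) i * f i)%N.

(* In the congruence, [k + r - j] is a subtraction in [nat]; it is only used
   for [j <= k]. *)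
Definition admissible (k j r : nat) : set frequency_sequence :=
  [set f : frequency_sequence |
    [/\ forall i : nat, (f i + f i.+1 <= k)%N,
        (f 0%N)%:Z <=
          j%:Z - Num.max ((f 0%N)%:Z + (f 1%N)%:Z - (k%:Z - r%:Z)) 0
      & forall i : nat, (f i + f i.+1)%N = k ->
          (i * f i + i.+1 * f i.+1 = k + r - j + 1 %[mod 2])%N ]]%classic.

(* Main.v *)
(* Let U_j, T_{j,r} be the multisums of the theorem without, respectively with,
   the last summand s_k of the exponent, all parts of f being moreover raised by
   m, i.e. q^i replaced by q^(i+m).  Splitting off n = s_k expresses them
   through the analogous Andrews-Gordon multisums (denominator (q)_{s_k}) with
   one variable less and m replaced by m + 2n.  An induction on k, in which the
   factor 1 - q^n coming from (q)_n is absorbed by summation by parts, gives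
     S_{j,r}(m) - S_{j-1,r-1}(m) = q^(mj) S_{k-r-j,0}(m+1)
   for the Andrews-Gordon sums S, and from it
     T_{j,r}(m) - T_{j-1,r-1}(m) = q^(mj) T_{k-r-j,0}(m+1)   (r >= 1),
     T_{j,0}(m) = U_{j-1}(m) + q^(mj) U_{k-1-j}(m+1),
     U_j(m) - U_{j-2}(m) = (q^(m(j-1)) + q^(mj)) U_{k-j}(m+1).
   Together these say that the multisums obey the recursion obtained on the
   combinatorial side by removing f_0.  Iterating it M times and using
   U_j(m), T_{j,r}(m) -> 1 as m -> oo identifies both sides.  Analytically
   nothing but finite sums is used: all gaps s_i - s_{i+1} are bounded by L, and
   the recursions hold up to an error tending to 0 with L, uniformly in m. *)
Require Import Defs.
From mathcomp Require Import all_boot all_order all_algebra finmap.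
From mathcomp Require Import classical_sets reals complex.
From mathcomp Require Import zify ring lra.
Import Order.TTheory GRing.Theory Num.Theory.
Local Open Scope ring_scope.
Local Open Scope complex_scope.

(* A state [(b, c, p)] stands for the frequency sequences f with
   f_0 <= b, 2 f_0 + f_1 <= c and the congruence (iii) with right-hand side
   [p]; choosing [f_0 = a] leads to the state
   [(next_bound k c p a, k + next_bound k c p a, p + k)] of the shifted sequence. *)
Definition allowed (k p a : nat) : bool := (a + odd (k + a + p) <= k)%N.

(** The bounds on [f_1] once [f_0 = a]: [k - a], lowered by one if [f_0 + f_1 = k] would violate the
    congruence at [i = 0], and [c - 2a]. *)
Definition next_bound (k c p a : nat) : nat :=
  minn (k - (a + odd (k + a + p))) (c - a.*2).

(** For [c = k + b] the bound on [2 f_0 + f_1] already follows from [f_0 <= b] and [f_0 + f_1 <= k].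
    Otherwise [c] and [p] have opposite parity. These are the states that the multisums
    represent. *)
Definition valid (k b c p : nat) : bool :=
  [&& b <= k, b.*2 <= c, c <= k + b & (c == k + b) || odd (p + c)]%N.

Lemma valid_next k b c p a : valid k b c p -> (a <= b)%N -> allowed k p a ->
  valid k (next_bound k c p a) (k + next_bound k c p a) (p + k).
Proof. by rewrite /valid /allowed /next_bound => /and4P[]; lia. Qed.

(** * Limits in the truncation level, uniform in the raise of the parts *)

Section Limits.
Set Implicit Arguments.
Unset Strict Implicit.
Variable K : numFieldType.
Implicit Types x y z : nat -> nat -> K.

(* In [x L m], [L] is the truncation level and [m] the amount by which the parts
   are raised; the limit in [L] is uniform in [m]. *)
Definition eqlim x y : Prop := forall e : K, 0 < e ->
  exists L0, forall L m, (L0 <= L)%N -> `|x L m - y L m| <= e.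

Lemma eqlim_ext x y : (forall L m, x L m = y L m) -> eqlim x y.
Proof.
by move=> xy e e0; exists 0%N => L m _; rewrite xy subrr normr0 ltW.
Qed.

Lemma eqlim_sym x y : eqlim x y -> eqlim y x.
Proof.
move=> xy e /xy[L0 HL]; exists L0 => L m hL.
by rewrite distrC HL.
Qed.

Lemma eqlim_trans y x z : eqlim x y -> eqlim y z -> eqlim x z.
Proof.
move=> xy yz e e0; have e20 : 0 < e / 2 by rewrite divr_gt0.
have [L1 H1] := xy _ e20; have [L2 H2] := yz _ e20.
exists (maxn L1 L2) => L m; rewrite geq_max => /andP[h1 h2].
by rewrite (splitr e) (le_trans (ler_distD (y L m) _ _)) // lerD ?H1 ?H2.
Qed.

Lemma eqlimD x y x' y' : eqlim x y -> eqlim x' y' ->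
  eqlim (fun L m => x L m + x' L m) (fun L m => y L m + y' L m).
Proof.
move=> xy xy' e e0; have e20 : 0 < e / 2 by rewrite divr_gt0.
have [L1 H1] := xy _ e20; have [L2 H2] := xy' _ e20.
exists (maxn L1 L2) => L m; rewrite geq_max => /andP[h1 h2].
by rewrite opprD addrACA (splitr e) (le_trans (ler_normD _ _)) // lerD ?H1 ?H2.
Qed.

(** The estimate is assumed for all [m] at once at a fixed [L], because the operators below evaluate
    their argument at other values of [m]. *)
Lemma eqlim_le (C : K) x y x' y' : 0 <= C -> eqlim x y ->
  (forall (d : K) L, 0 <= d -> (forall m, `|x L m - y L m| <= d) ->
     forall m, `|x' L m - y' L m| <= C * d) ->
  eqlim x' y'.
Proof.
move=> C0 xy H e e0; have C1 : 0 < C + 1 by rewrite ltr_wpDl.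
have e'0 : 0 < e / (C + 1) by rewrite divr_gt0.
have [L0 HL] := xy _ e'0; exists L0 => L m hL.
apply: (le_trans (H _ L (ltW e'0) (fun m => HL L m hL) m)).
by rewrite mulrCA ger_pMr // ler_pdivrMr // mul1r lerDl.
Qed.

Lemma eqlim_sum (n : nat) (P : pred nat) (X Y : nat -> nat -> nat -> K) :
  (forall i, (i < n)%N -> P i -> eqlim (X i) (Y i)) ->
  eqlim (fun L m => \sum_(i < n | P i) X i L m)
        (fun L m => \sum_(i < n | P i) Y i L m).
Proof.
elim: n => [|n IHn] XY; first by apply: eqlim_ext => L m; rewrite !big_ord0.
have E (Z : nat -> nat -> nat -> K) L m : \sum_(i < n.+1 | P i) Z i L m =
    \sum_(i < n | P i) Z i L m + (if P n then Z n L m else 0).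
  by rewrite [LHS]big_mkcond big_ord_recr /= -big_mkcond.
apply: eqlim_trans (eqlim_ext (E X)) _.
apply: eqlim_trans _ (eqlim_sym (eqlim_ext (E Y))).
apply: eqlimD; first by apply: IHn => i ilt; apply: XY; rewrite ltnW.
case: (boolP (P n)) => Pn; last by apply: eqlim_ext.
  exact: XY (ltnSn n) Pn.
Qed.

End Limits.

(** * Recursions for the truncated multisums *)

Section Transform.
Set Implicit Arguments.
Unset Strict Implicit.
Variable K : numFieldType.
Hypothesis exprn_small :
  forall x e : K, 0 <= x -> x < 1 -> 0 < e -> exists n, x ^+ n < e.

Lemma exprn_eventually_small (x e : K) : 0 <= x -> x < 1 -> 0 < e ->
  exists N, forall n, (N <= n)%N -> x ^+ n <= e.
Proof.
move=> x0 x1 e0; have [N HN] := exprn_small x0 x1 e0.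
exists N => n Nn; rewrite (le_trans _ (ltW HN)) //.
by rewrite ler_wiXn2l ?x0 ?ltW.
Qed.

(** The left side is the [n]-th power of [rho * t ^+ n.-1], a base that eventually drops below
    1/2. *)
Lemma gauss_half (rho t : K) : 0 <= rho -> 0 <= t -> t < 1 ->
  exists N, forall n, (N <= n)%N ->
    rho ^+ n * t ^+ (n * n.-1) <= 2^-1 ^+ n.
Proof.
move=> rho0 t0 t1; have r1 : 0 < rho + 1 by rewrite ltr_wpDl.
have e0 : 0 < 2^-1 / (rho + 1) by rewrite divr_gt0 ?invr_gt0.
have [N HN] := exprn_eventually_small t0 t1 e0.
exists N.+1 => -[|n] // Nn; rewrite mulnC exprM -exprMn lerXn2r ?nnegrE //.
- by rewrite mulr_ge0 ?exprn_ge0.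
- by rewrite invr_ge0.
have := HN n Nn; rewrite ler_pdivlMr //= => h.
by rewrite (le_trans _ h) // mulrC ler_wpM2l ?exprn_ge0 // lerDl.
Qed.

Lemma gauss_small (rho t e : K) : 0 <= rho -> 0 <= t -> t < 1 -> 0 < e ->
  exists N, forall n, (N <= n)%N -> rho ^+ n * t ^+ (n * n.-1) <= e.
Proof.
move=> rho0 t0 t1 e0.
have [N1 H1] := gauss_half rho0 t0 t1.
have h0 : 0 <= 2^-1 :> K by rewrite invr_ge0.
have h1 : 2^-1 < 1 :> K by rewrite invf_lt1 // ltr1n.
have [N2 H2] := exprn_eventually_small h0 h1 e0.
exists (maxn N1 N2) => n; rewrite geq_max => /andP[n1 n2].
exact: le_trans (H1 _ n1) (H2 _ n2).
Qed.

Lemma gauss_sum (rho t : K) : 0 <= rho -> 0 <= t -> t < 1 ->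
  exists2 W, 0 <= W &
    forall L, \sum_(n < L) rho ^+ n * t ^+ (n * n.-1) <= W.
Proof.
move=> rho0 t0 t1; have [N HN] := gauss_half rho0 t0 t1.
pose a n := rho ^+ n * t ^+ (n * n.-1).
have a0 n : 0 <= a n by rewrite mulr_ge0 ?exprn_ge0.
have geo L : \sum_(n < L) (2^-1 : K) ^+ n <= 2.
  suff -> : \sum_(n < L) (2^-1 : K) ^+ n = 2 - 2 * 2^-1 ^+ L.
    by rewrite gerBl mulr_ge0 ?exprn_ge0 ?invr_ge0.
  elim: L => [|L IHL]; first by rewrite big_ord0 expr0 mulr1 subrr.
  by rewrite big_ord_recr /= IHL exprS; field.
exists (\sum_(n < N) a n + 2).
  by rewrite addr_ge0 ?sumr_ge0.
have W0 L : \sum_(n < L) a n <= \sum_(n < N) a n + \sum_(n < L) (2^-1 : K) ^+ n.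
  elim: L => [|L IHL]; first by rewrite !big_ord0 addr0 sumr_ge0.
  have [LN|NL] := ltnP L N.
    rewrite ler_wpDr //; first by rewrite sumr_ge0 // => n _; rewrite exprn_ge0 ?invr_ge0.
    rewrite (big_ord_widen N a LN) [leLHS]big_mkcond ler_sum // => n _.
    by case: ifP.
  by rewrite !big_ord_recr /= addrA lerD ?HN.
by move=> L; rewrite (le_trans (W0 L)) // lerD.
Qed.

(** * Operators that split off the smallest part *)

Variables (q : K) (q1 : `|q| < 1).
Implicit Types x y : nat -> nat -> K.
Implicit Type w : nat -> K.

(** Writing each of [k] parts as [n + x] with [n = s_k] gives [(n+x)^2 + m(n+x) = (n^2 + mn) + x^2 +
    (m+2n)x], whence the [k] copies of [n^2 + mn] and the new raise [m + 2n]. The linear terms added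
    and subtracted in the exponent contribute [d] and [e]. *)
Definition qtrans w k e d x L m : K :=
  \sum_(n < L) w n * q ^+ (k * (n * n + m * n) + d * n - e * n) * x L (m + n.*2)%N.

(** On the combinatorial side: the effect of fixing [f_0 = h] and renumbering the remaining
    entries. *)
Definition shift h x L m : K := q ^+ (m * h) * x L m.+1.

Lemma shift_eqlim h x y : eqlim x y -> eqlim (shift h x) (shift h y).
Proof.
move=> xy; apply: (@eqlim_le _ 1 x y) => // d L d0 H m.
rewrite -mulrBr normrM normrX ler_pM ?exprn_ge0 ?H //.
by rewrite exprn_ile1 // ltW.
Qed.

Definition geometric w := exists2 rho, 0 <= rho & forall n, `|w n| <= rho ^+ n.

(** The summand [n * n.-1] makes the series converge; [m * n] makes all terms but [n = 0] decay as
    [m] grows. *)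
Lemma qtrans_exponent k e d m n : (0 < k)%N -> (e <= k + d)%N ->
  (n * n.-1 + m * n <= k * (n * n + m * n) + d * n - e * n)%N.
Proof.
move=> k0 ek; case: n => [|n]; first by rewrite !muln0.
rewrite /=; have h : (e * n.+1 <= k * n.+1 + d * n.+1)%N by rewrite -mulnDl leq_mul2r ek orbT.
have h2 : (n.+1 * n <= k * (n.+1 * n))%N by rewrite leq_pmull.
have h3 : (m * n.+1 <= k * (m * n.+1))%N by rewrite leq_pmull.
have -> : (k * (n.+1 * n.+1 + m * n.+1) = k * (n.+1 * n) + k * n.+1 + k * (m * n.+1))%N by ring.
lia.
Qed.

Lemma qtrans_coef_le w rho k e d m n : (0 < k)%N -> (e <= k + d)%N ->
  0 <= rho -> `|w n| <= rho ^+ n ->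
  `|w n * q ^+ (k * (n * n + m * n) + d * n - e * n)| <=
    rho ^+ n * `|q| ^+ (n * n.-1).
Proof.
move=> k0 ek rho0 wn; rewrite normrM normrX ler_pM ?exprn_ge0 //.
apply: ler_wiXn2l => //; first exact: ltW.
exact: leq_trans (leq_addr _ _) (@qtrans_exponent k e d m n k0 ek).
Qed.

Lemma qtrans_bound w k : geometric w -> (0 < k)%N ->
  exists2 W, 0 <= W & forall e d x L m b, (e <= k + d)%N -> 0 <= b ->
    (forall m', `|x L m'| <= b) -> `|qtrans w k e d x L m| <= W * b.
Proof.
move=> [rho rho0 wn] k0; have [W W0 HW] := gauss_sum rho0 (normr_ge0 q) q1.
exists W => // e d x L m b ek b0 xb.
rewrite (le_trans (ler_norm_sum _ _ _)) //.
rewrite (le_trans _ (ler_wpM2r b0 (HW L))) // mulr_suml ler_sum // => n _.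
by rewrite normrM ler_pM // qtrans_coef_le.
Qed.

Lemma qtrans_linear w k e d x y L m :
  qtrans w k e d (fun L m => x L m - y L m) L m =
  qtrans w k e d x L m - qtrans w k e d y L m.
Proof. by rewrite /qtrans -sumrB; apply: eq_bigr => n _; rewrite mulrBr. Qed.

Lemma qtrans_add w k e d x y L m :
  qtrans w k e d (fun L m => x L m + y L m) L m =
  qtrans w k e d x L m + qtrans w k e d y L m.
Proof. by rewrite /qtrans -big_split; apply: eq_bigr => n _; rewrite mulrDr. Qed.

Lemma qtrans_eqlim w k e d x y : geometric w -> (0 < k)%N -> (e <= k + d)%N ->
  eqlim x y -> eqlim (qtrans w k e d x) (qtrans w k e d y).
Proof.
move=> gw k0 ek xy; have [W W0 HW] := qtrans_bound gw k0.
apply: (@eqlim_le _ W x y) => // b L b0 H m.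
by rewrite -qtrans_linear; apply: HW.
Qed.

Lemma qtrans_exponent_le k e d m n : (e <= k + d)%N ->
  (e * n <= k * (n * n + m * n) + d * n)%N.
Proof.
move=> ek; rewrite (leq_trans (leq_mul ek (leqnn n))) // mulnDl leq_add2r.
by rewrite leq_mul //; case: n => // n; rewrite (leq_trans _ (leq_addr _ _)) // leq_pmulr.
Qed.

Lemma expr_collectr (b c : nat) (u v : K) :
  u * q ^+ b * (q ^+ c * v) = u * q ^+ (b + c) * v.
Proof. by rewrite exprD; ring. Qed.

Lemma expr_collectl (a b : nat) (u v : K) :
  q ^+ a * (u * q ^+ b * v) = u * q ^+ (a + b) * v.
Proof. by rewrite exprD; ring. Qed.

(** The condition compares the coefficients of [n] in the exponents: [shift h] taken at [m + 2n]
    contributes [2 * h] on the left, and raising [m] by one contributes [k] on the right. *)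
Lemma qtrans_shift w k e d e' d' h x : (e <= k + d)%N -> (e' <= k + d')%N ->
  (d + 2 * h + e' = k + d' + e)%N ->
  forall L m, qtrans w k e d (shift h x) L m = shift h (qtrans w k e' d' x) L m.
Proof.
move=> ek ek' E L m; rewrite /shift /qtrans mulr_sumr; apply: eq_bigr => n _.
rewrite expr_collectr expr_collectl addSn.
congr (_ * q ^+ _ * _).
have A1 := @qtrans_exponent_le k e d m n ek.
have A2 := @qtrans_exponent_le k e' d' m.+1 n ek'.
have A3 : ((d + 2 * h + e') * n = (k + d' + e) * n)%N by rewrite E.
lia.
Qed.

(* Summation by parts: the factor [1 - q ^+ (d * n)] cancels the last factor
   of the weight, and [n] is shifted by one. *)
Lemma qtrans_diff w k e d x b : geometric w -> (0 < k)%N -> (e <= k)%N ->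
  (forall n, w n = w n.+1 * (1 - q ^+ (d * n.+1))) ->
  (forall L m, `|x L m| <= b) ->
  eqlim (fun L m => qtrans w k e 0 x L m - qtrans w k e d x L m)
        (shift e (qtrans w k (k - e) 0 (shift (k - e) x))).
Proof.
move=> [rho rho0 wn] k0 ek wS xb.
have b0 : 0 <= b := le_trans (normr_ge0 _) (xb 0%N 0%N).
(* Boundary term: after the shift by one the right-hand sum also contains the index [L.+1], cut off
   on the left. It vanishes in the limit by Gaussian decay. *)
pose r L m := w L * q ^+ (k * (L.+1 * L.+1 + m * L.+1) - e * L.+1).
have E L m : qtrans w k e 0 x L.+1 m - qtrans w k e d x L.+1 m =
  shift e (qtrans w k (k - e) 0 (shift (k - e) x)) L.+1 m
    - r L m * x L.+1 (m + L.+1.*2)%N.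
  rewrite /qtrans /shift mulr_sumr -sumrB big_ord_recl big_ord_recr /= !muln0 subrr add0r.
  have ekn n : (e * n <= k * (n * n + m * n))%N.
    by have := @qtrans_exponent_le k e 0 m n; rewrite mul0n !addn0; apply.
  have H n : q ^+ (m * e) * (w n * q ^+ (k * (n * n + m.+1 * n) + 0 * n - (k - e) * n) *
      (q ^+ ((m.+1 + n.*2) * (k - e)) * x L.+1 (m.+1 + n.*2).+1)) =
      r n m * x L.+1 (m + n.+1.*2)%N.
    rewrite expr_collectr expr_collectl doubleS !addnS addSn; congr (_ * q ^+ _ * _).
    have A1 := @qtrans_exponent_le k (k - e) 0 m.+1 n.
    have A2 := ekn n.+1; nia.
  rewrite H addrK; apply: eq_bigr => n _; rewrite H /bump /= add1n.
  rewrite mul0n addn0 -mulrBl -mulrBr /r; congr (_ * _).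
  by rewrite (addnC _ (d * n.+1)%N) -addnBA // exprD [in RHS]wS; ring.
move=> eps eps0; have b1 : 0 < b + 1 by rewrite ltr_wpDl.
have [N HN] := gauss_small rho0 (normr_ge0 q) q1 (divr_gt0 eps0 b1).
exists N.+1 => -[//|L] m NL; rewrite E addrAC subrr add0r normrN normrM.
rewrite (@le_trans _ _ (eps / (b + 1) * b)) //; last first.
  by rewrite mulrAC ler_pdivrMr // ler_pM2l // lerDl.
apply: ler_pM => //; rewrite (le_trans _ (HN L NL)) // /r normrM normrX.
rewrite ler_pM ?exprn_ge0 // ler_wiXn2l ?normr_ge0 //; first exact: ltW.
have := @qtrans_exponent k e 0 m L.+1 k0; rewrite addn0 => /(_ ek) /=; nia.
Qed.

(** The term [n = 0] is [x L m] itself, and every other term carries a factor [q ^+ m]. For [L = 0]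
    the sum is empty, whence [0 < L]. *)
Lemma qtrans_near1 w k : geometric w -> (0 < k)%N -> w 0%N = 1 ->
  exists2 W, 0 <= W & forall e d x b, (e <= k + d)%N -> 0 <= b ->
    (forall L m, (0 < L)%N -> `|x L m - 1| <= b * `|q| ^+ m) ->
    forall L m, (0 < L)%N ->
      `|qtrans w k e d x L m - 1| <= (b + W * (b + 1)) * `|q| ^+ m.
Proof.
move=> [rho rho0 wn] k0 w0.
have [W W0 HW] := gauss_sum rho0 (normr_ge0 q) q1.
exists W => // e d x b ek b0 xb [//|L] m _.
have xb1 m' : `|x L.+1 m'| <= b + 1.
  rewrite -[x _ _](subrK 1) (le_trans (ler_normD _ _)) // normr1 lerD2r.
  by rewrite (le_trans (xb _ _ _)) // ler_piMr // exprn_ile1 // ltW.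
rewrite /qtrans big_ord_recl /= !muln0 !addn0 w0 mul1r expr0 mul1r addrAC.
rewrite (le_trans (ler_normD _ _)) // mulrDl lerD ?xb //.
rewrite (le_trans (ler_norm_sum _ _ _)) // mulrAC.
rewrite (@le_trans _ _ (\sum_(n < L.+1) rho ^+ n * `|q| ^+ (n * n.-1) *
    (`|q| ^+ m * (b + 1)))) //; last first.
  rewrite -mulr_suml -[leRHS]mulrA; apply: ler_wpM2r => //.
  by rewrite mulr_ge0 ?exprn_ge0 ?addr_ge0.
rewrite [leRHS]big_ord_recl ler_wpDl //; first by rewrite !mulr_ge0 ?exprn_ge0 ?addr_ge0.
apply: ler_sum => n _; rewrite /bump add1n normrM mulrA ler_pM // normrM -mulrA.
rewrite ler_pM // normrX -exprD ler_wiXn2l //; first exact: ltW.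
rewrite lift0 (leq_trans _ (@qtrans_exponent k e d m n.+1 k0 ek)) // leq_add2l.
by rewrite leq_pmulr.
Qed.

Lemma qtrans_ge1 w k e d x : (0 <= q) -> (forall n, 0 <= w n) -> w 0%N = 1 ->
  (forall L m, (0 < L)%N -> 1 <= x L m) ->
  forall L m, (0 < L)%N -> 1 <= qtrans w k e d x L m.
Proof.
move=> q0 w_ge0 w0 x1 [//|L] m _; rewrite /qtrans big_ord_recl /= !muln0 w0 !mul1r.
rewrite ler_wpDr ?x1 // sumr_ge0 // => n _.
by rewrite !mulr_ge0 ?exprn_ge0 // (le_trans ler01) ?x1.
Qed.

(* [ag_sum k j.+1 r] is the sum over s_1 >= ... >= s_k >= 0 of the paper with the
   Andrews-Gordon denominator (q)_{s_k}, every part weighted by an additional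
   q^m; the index [0] stands for the empty sum. *)
Fixpoint ag_sum w k h r : nat -> nat -> K :=
  if k is k'.+1 then qtrans w k h.-1 r (ag_sum w k' (minn h k) r.-1)
  else fun _ _ => (0 < h)%:R.

Variable w : nat -> K.
Hypothesis w_geom : geometric w.
Hypothesis w0 : w 0%N = 1.

Lemma ag_sum_h0 k r L m : ag_sum w k 0 r L m = 0.
Proof.
elim: k r m => [|k IHk] r m //=.
by rewrite /qtrans big1 // => n _; rewrite min0n IHk mulr0.
Qed.

Lemma ag_sum_bound k : exists2 B, 0 <= B &
  forall h r L m, (h <= k.+1)%N -> `|ag_sum w k h r L m| <= B.
Proof.
elim: k => [|k [B B0 HB]].
  by exists 1 => // h r L m _ /=; case: (0 < h)%N; rewrite ?normr1 ?normr0.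
have [W W0 HW] := qtrans_bound w_geom (ltn0Sn k).
exists (W * B); first exact: mulr_ge0.
move=> h r L m hk /=; apply: HW => //; first lia.
by move=> m'; apply: HB; lia.
Qed.

Lemma ag_sum_near1 k : exists2 B, 0 <= B &
  forall h r L m, (0 < h <= k.+1)%N -> (0 < L)%N ->
    `|ag_sum w k h r L m - 1| <= B * `|q| ^+ m.
Proof.
elim: k => [|k [B B0 HB]].
  by exists 0 => // h r L m /andP[h0 _] _ /=; rewrite h0 subrr normr0 mul0r.
have [W W0 HW] := qtrans_near1 w_geom (ltn0Sn k) w0.
exists (B + W * (B + 1)); first by rewrite addr_ge0 ?mulr_ge0 ?addr_ge0.
move=> h r L m hk L0 /=; apply: HW => //; first lia.
by move=> L' m' L'0; apply: HB => //; lia.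
Qed.

Lemma ag_sum_ge1 k h r L m : 0 <= q -> (forall n, 0 <= w n) ->
  (0 < h <= k.+1)%N -> (0 < L)%N -> 1 <= ag_sum w k h r L m.
Proof.
move=> q0 w_ge0; elim: k h r L m => [|k IHk] h r L m hk L0 /=.
  by case/andP: hk => ->.
by apply: qtrans_ge1 => // L' m' L'0; apply: IHk => //; lia.
Qed.

Hypothesis wS : forall n, w n = w n.+1 * (1 - q ^+ n.+1).

Lemma shift_add h x y L m :
  shift h (fun L m => x L m + y L m) L m = shift h x L m + shift h y L m.
Proof. exact: mulrDr. Qed.

Lemma qtrans_succ w' k e d x L m : qtrans w' k e.+1 d.+1 x L m = qtrans w' k e d x L m.
Proof.
apply: eq_bigr => n _; congr (_ * _ ^+ _ * _).
by rewrite !mulSn (addnC n (d * n)%N) addnA (addnC n) subnDr.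
Qed.

(** Lowering [e] and [d] together leaves the exponent unchanged; at [h = 0], where the predecessor
    is truncated, both sides vanish. *)
Lemma qtrans_pred_ag w' k k' h l d r L m :
  qtrans w' k h.-1 d (ag_sum w k' (minn h l) r) L m =
  qtrans w' k h d.+1 (ag_sum w k' (minn h l) r) L m.
Proof.
case: h => [|h]; last by rewrite qtrans_succ.
by rewrite /qtrans !big1 // => n _; rewrite min0n ag_sum_h0 mulr0.
Qed.

Definition rec_at k h r := eqlim (ag_sum w k h.+1 r)
  (fun L m => ag_sum w k h r.-1 L m + shift h (ag_sum w k (k - r - h).+1 0) L m).

(** Extends the recursion beyond [h <= k]: there both minima equal [k.+1], and the shifted sum has
    index 0, hence is empty. *)
Lemma rec_at_minn k h : ((h <= k)%N -> rec_at k h 0) ->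
  eqlim (ag_sum w k (minn h.+1 k.+1) 0)
    (fun L m => ag_sum w k (minn h k.+1) 0 L m + shift h (ag_sum w k (k.+1 - h) 0) L m).
Proof.
have [hk|kh] := leqP h k => IH.
  have := IH isT; rewrite /rec_at subn0.
  by rewrite (minn_idPl _) 1?(minn_idPl _) ?subSn // ltnW.
have -> : minn h.+1 k.+1 = minn h k.+1 by lia.
have -> : (k.+1 - h = 0)%N by lia.
by apply: eqlim_ext => L m; rewrite /shift ag_sum_h0 mulr0 addr0.
Qed.

(** One more summation, applied to the recursion for [r], gives the one for [r.+1] by linearity. The
    constant [c] is 0 for the Andrews-Gordon sums and 1 when the exponent has the extra [s_k]. *)
Lemma qtrans_rec w' k h r c : geometric w' -> (h + r <= k)%N -> rec_at k h r ->
  eqlim (qtrans w' k.+1 h (r.+1 + c) (ag_sum w k (minn h.+1 k.+1) r))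
    (fun L m => qtrans w' k.+1 h.-1 (r + c) (ag_sum w k (minn h k.+1) r.-1) L m +
       shift h (qtrans w' k.+1 (k - r - h) c (ag_sum w k (minn (k - r - h).+1 k.+1) 0)) L m).
Proof.
move=> gw' hrk IH; have -> : minn h.+1 k.+1 = h.+1 by lia.
apply: eqlim_trans (qtrans_eqlim gw' (ltn0Sn k) _ IH) _; first lia.
apply: eqlim_ext => L m; rewrite qtrans_add qtrans_pred_ag addSn.
have -> : minn h k.+1 = h by lia.
have -> : minn (k - r - h).+1 k.+1 = (k - r - h).+1 by lia.
by congr (_ + _); apply: qtrans_shift; lia.
Qed.

(** Only [r = 0] needs more than linearity: the induction hypothesis yields [qtrans] with [d = 0]
    where [d = 1] is wanted, and summation by parts accounts for the difference. *)
Lemma ag_sum_rec k h r : (h + r <= k)%N -> rec_at k h r.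
Proof.
elim: k h r => [|k IHk] h r hrk.
  apply: eqlim_ext => L m; have [-> ->] : h = 0%N /\ r = 0%N by lia.
  by rewrite /shift /= muln0 expr0 mul1r add0r.
case: r hrk => [|r] hrk; last first.
  have hr : (h + r <= k)%N by lia.
  have := @qtrans_rec w k h r 0 w_geom hr (IHk _ _ hr).
  by rewrite /rec_at /= !addn0 subSS.
have IH0 h' := @rec_at_minn k h' (fun hk => IHk h' 0%N (etrans (congr1 (leq^~ k) (addn0 h')) hk)).
rewrite addn0 in hrk; rewrite /rec_at subn0 /=.
set X := ag_sum w k (minn h k.+1) 0; set Y := ag_sum w k (k.+1 - h) 0.
pose P := qtrans w k.+1 (k.+1 - h) 0.
have [B B0 HB] := ag_sum_bound k.
have D : eqlim (fun L m => qtrans w k.+1 h 0 X L m - qtrans w k.+1 h 1 X L m)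
    (shift h (P (shift (k.+1 - h) X))).
  apply: (@qtrans_diff _ _ _ _ _ B) => //.
  - by move=> n; rewrite mul1n.
  - by move=> L m; apply: HB; lia.
pose A L m := qtrans w k.+1 h 1 X L m + shift h (P Y) L m.
apply: eqlim_trans (_ : eqlim _ (fun L m => (qtrans w k.+1 h 0 X L m - qtrans w k.+1 h 1 X L m) + A L m)) _.
  apply: eqlim_trans (qtrans_eqlim w_geom _ _ (IH0 h)) _ => //; first lia.
  apply: eqlim_ext => L m; rewrite qtrans_add (@qtrans_shift _ _ _ _ (k.+1 - h) 0); try lia.
  by rewrite /A addrA subrK.
apply: eqlim_trans (eqlimD D (eqlim_ext (fun _ _ => erefl))) _.
apply: eqlim_trans (_ : eqlim _ (fun L m => qtrans w k.+1 h 1 X L m + shift h (P (fun L m => Y L m + shift (k.+1 - h) X L m)) L m)) _.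
  apply: eqlim_ext => L m; rewrite /A /shift /P qtrans_add; ring.
apply: eqlimD; first by apply: eqlim_ext => L m; rewrite /X -qtrans_pred_ag.
apply: shift_eqlim; apply: qtrans_eqlim => //; first lia.
(* The recursion at [k.+1 - h], read from right to left, merges [Y] and the term left by summation
   by parts. *)
apply: eqlim_sym; apply: eqlim_trans (IH0 _) _.
apply: eqlim_ext => L m; rewrite /X /Y subKn //.
have -> : minn h k.+1 = h by lia.
by have -> : minn (k.+1 - h) k.+1 = (k.+1 - h)%N by lia.
Qed.

Lemma ag_sum_rec0 k h :
  eqlim (ag_sum w k (minn h.+1 k.+1) 0)
    (fun L m => ag_sum w k (minn h k.+1) 0 L m + shift h (ag_sum w k (k.+1 - h) 0) L m).
Proof. by apply: rec_at_minn => hk; apply: ag_sum_rec; rewrite addn0. Qed.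

(** * Multisums with last denominator [(q^2;q^2)] *)

Variable w' : nat -> K.
Hypothesis w'_geom : geometric w'.
Hypothesis w'0 : w' 0%N = 1.
Hypothesis w'S : forall n, w' n = w' n.+1 * (1 - q ^+ (2 * n.+1)).

(* [bressoud_sum k h.+1 r] is the multisum of the theorem with [k.+1] summation
   variables and [j = h]; [bressoud_sum0 k h.+1] differs from
   [bressoud_sum k h.+1 0] by the absence of the last summand s_k of the
   exponent. *)
Definition bressoud_sum k h r := qtrans w' k.+1 h.-1 r.+1 (ag_sum w k (minn h k.+1) r.-1).
Definition bressoud_sum0 k h := qtrans w' k.+1 h.-1 0 (ag_sum w k (minn h k.+1) 0).

Lemma bressoud_sum_h0 k r L m : bressoud_sum k 0 r L m = 0.
Proof. by apply: big1 => n _; rewrite min0n ag_sum_h0 mulr0. Qed.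

Lemma bressoud_sum0_h0 k L m : bressoud_sum0 k 0 L m = 0.
Proof. by apply: big1 => n _; rewrite min0n ag_sum_h0 mulr0. Qed.

Lemma bressoud_sum_rec k h r : (h + r <= k)%N ->
  eqlim (bressoud_sum k h.+1 r.+1)
    (fun L m => bressoud_sum k h r L m + shift h (bressoud_sum k (k - r - h).+1 0) L m).
Proof.
move=> hrk; have := @qtrans_rec w' k h r 1 w'_geom hrk (ag_sum_rec hrk).
by rewrite !addn1.
Qed.

(** Here the extra [s_k] already provides [d = 1], so linearity suffices; it is used up in lowering
    [e], which leaves sums without it. *)
Lemma bressoud_sum_rec0 k h : (h <= k.+1)%N ->
  eqlim (bressoud_sum k h.+1 0) (fun L m => bressoud_sum0 k h L m + shift h (bressoud_sum0 k (k.+1 - h)) L m).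
Proof.
move=> hk; apply: eqlim_trans (qtrans_eqlim w'_geom (ltn0Sn k) _ (ag_sum_rec0 k h)) _.
  by lia.
apply: eqlim_ext => L m; rewrite qtrans_add -qtrans_pred_ag; congr (_ + _).
have [hk'|kh] := leqP h k.
  rewrite (@qtrans_shift _ _ _ _ (k - h) 0); try lia.
  rewrite /bressoud_sum0; have -> : minn (k.+1 - h) k.+1 = (k.+1 - h)%N by lia.
  by rewrite subSn.
have -> : (k.+1 - h = 0)%N by lia.
by rewrite /shift bressoud_sum0_h0 mulr0 /qtrans big1 // => n _; rewrite ag_sum_h0 !mulr0.
Qed.

(** The weight [w'] absorbs [1 - q^(2n)], so summation by parts passes from [d = 0] to [d = 2]; this
    is why [h] moves by two. The Andrews-Gordon recursion enters at [h.+1] ([E1]), at [h] ([E2])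
    and, backwards, at [k - h] ([E3]). *)
Lemma bressoud_sum0_rec k h : (h <= k)%N ->
  eqlim (bressoud_sum0 k h.+2) (fun L m => bressoud_sum0 k h L m +
    (shift h (bressoud_sum0 k (k.+1 - h)) L m + shift h.+1 (bressoud_sum0 k (k.+1 - h)) L m)).
Proof.
move=> hk; rewrite /bressoud_sum0 /= (_ : (k.+1 - h).-1 = k - h)%N; last lia.
have hk1 : (h.+1 <= k.+1 + 0)%N by lia.
have hk2 : (h.+1 <= k.+1 + 2)%N by lia.
set X0 := ag_sum w k (minn h k.+1) 0; pose X1 := ag_sum w k (minn h.+1 k.+1) 0.
pose P := qtrans w' k.+1 (k - h) 0.
set Y1 := ag_sum w k (minn (k.+1 - h) k.+1) 0.
pose Y0 := ag_sum w k (k - h) 0.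
have [B B0 HB] := ag_sum_bound k.
have D : eqlim (fun L m => qtrans w' k.+1 h.+1 0 X1 L m - qtrans w' k.+1 h.+1 2 X1 L m)
    (shift h.+1 (P (shift (k - h) X1))).
  rewrite -(subSS h k); apply: (@qtrans_diff _ _ _ _ _ B) => //.
  by move=> L m; apply: HB; lia.
have E1 : eqlim (qtrans w' k.+1 h.+1 0 (ag_sum w k (minn h.+2 k.+1) 0))
    (fun L m => qtrans w' k.+1 h.+1 0 X1 L m + shift h.+1 (P Y0) L m).
  apply: eqlim_trans (qtrans_eqlim w'_geom (ltn0Sn k) hk1 (ag_sum_rec0 k h.+1)) _.
  apply: eqlim_ext => L m; rewrite qtrans_add subSS; congr (_ + _).
  by apply: qtrans_shift; lia.
have E2 : eqlim (qtrans w' k.+1 h.+1 2 X1)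
    (fun L m => qtrans w' k.+1 h.-1 0 X0 L m + shift h (P Y1) L m).
  apply: eqlim_trans (qtrans_eqlim w'_geom (ltn0Sn k) hk2 (ag_sum_rec0 k h)) _.
  apply: eqlim_ext => L m; rewrite qtrans_add qtrans_succ -qtrans_pred_ag.
  congr (_ + _); rewrite /Y1 (_ : minn (k.+1 - h) k.+1 = k.+1 - h)%N; last lia.
  by apply: qtrans_shift; lia.
have E3 : eqlim (shift h.+1 (P Y1))
    (fun L m => shift h.+1 (P Y0) L m + shift h.+1 (P (shift (k - h) X1)) L m).
  apply: eqlim_trans (_ : eqlim _ (shift h.+1 (P (fun L m => Y0 L m + shift (k - h) X1 L m)))) _.
    apply: shift_eqlim; apply: qtrans_eqlim => //; first lia.
    have := ag_sum_rec0 k (k - h); rewrite -subSn // /Y1 /Y0 /X1.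
    have -> : minn (k - h) k.+1 = (k - h)%N by lia.
    by have -> : (k.+1 - (k - h) = minn h.+1 k.+1)%N by lia.
  by apply: eqlim_ext => L m; rewrite -shift_add /shift /P qtrans_add.
apply: eqlim_trans E1 _.
apply: eqlim_trans (_ : eqlim _ (fun L m => qtrans w' k.+1 h.+1 2 X1 L m +
  (shift h.+1 (P Y0) L m + (qtrans w' k.+1 h.+1 0 X1 L m - qtrans w' k.+1 h.+1 2 X1 L m)))) _.
  by apply: eqlim_ext => L m; ring.
apply: eqlim_trans (eqlimD E2 (eqlim_trans (eqlimD (eqlim_ext (fun _ _ => erefl)) D)
  (eqlim_sym E3))) _.
by apply: eqlim_ext => L m; rewrite addrA.
Qed.

(** At [h = 0] the first term of the Andrews-Gordon recursion is empty; the remaining one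
    corresponds to the only choice [f_0 = 0]. *)
Lemma bressoud_sum0_rec1 k : eqlim (bressoud_sum0 k 1) (shift 0 (bressoud_sum0 k k.+2)).
Proof.
apply: eqlim_trans (qtrans_eqlim w'_geom (ltn0Sn k) _ (ag_sum_rec0 k 0)) _ => //.
apply: eqlim_ext => L m; rewrite qtrans_add subn0 /bressoud_sum0.
rewrite (@qtrans_shift _ _ _ _ k.+1 0) ?(minn_idPr (leqnSn _)) ?addn0 //.
by rewrite {1}/qtrans big1 ?add0r // => n _; rewrite min0n ag_sum_h0 mulr0.
Qed.

(** Each two-step recursion adds the terms [a = b - 1] and [a = b], which share one sum;
    [odd (a + b)] encodes this pairing. *)
Lemma bressoud_sum0_unfold k b : (b <= k.+1)%N ->
  eqlim (bressoud_sum0 k b.+1) (fun L m =>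
    \sum_(a < b.+1) shift a (bressoud_sum0 k (k.+1 - (a + odd (a + b))).+1) L m).
Proof.
elim/ltn_ind: b => -[|[|b]] IH bk.
- apply: eqlim_trans (bressoud_sum0_rec1 k) _.
  by apply: eqlim_ext => L m; rewrite big_ord1 subn0.
- apply: eqlim_trans (bressoud_sum0_rec (leq0n k)) _.
  apply: eqlim_ext => L m; rewrite bressoud_sum0_h0 add0r big_ord_recr big_ord1 /=.
  by rewrite subn0 subSS subn0.
apply: eqlim_trans (@bressoud_sum0_rec k b.+1 _) _; first lia.
have E := eqlimD (IH b (ltnW (leqnn _)) (ltnW (ltnW bk)))
  (eqlim_ext (fun _ _ => erefl)).
apply: eqlim_trans (E _) _.
apply: eqlim_ext => L m; rewrite [in RHS]big_ord_recr [in RHS]big_ord_recr /= -addrA.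
congr (_ + (_ + _)).
- by apply: eq_bigr => a _; rewrite !addnS /= negbK.
- by congr (shift _ (bressoud_sum0 _ _) _ _); lia.
- by congr (shift _ (bressoud_sum0 _ _) _ _); lia.
Qed.

(** If [p + c] is odd, [r] is recovered from [c = k.+1 + b - r]. If it is even, a valid state has
    [c = k.+1 + b], and the sum without the extra [s_k] takes over. *)
Definition state_sum k b c p : nat -> nat -> K :=
  if odd (p + c) then bressoud_sum k b.+1 (k.+1 + b - c) else bressoud_sum0 k b.+1.

(** Lowering [h] and [r] together keeps [c] fixed, so the recursion peels off the largest [f_0]
    inside one state. Once [r = 0], one step leads to [bressoud_sum0], which is unfolded
    completely. *)
Lemma bressoud_sum_unfold k h r c p : (h <= k.+2)%N -> (c + r.+1 = k.+1 + h)%N ->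
  (h.*2 <= c.+2)%N -> odd (p + c) ->
  eqlim (bressoud_sum k h r) (fun L m => \sum_(a < h | allowed k.+1 p a)
    shift a (state_sum k (next_bound k.+1 c p a) (k.+1 + next_bound k.+1 c p a) (p + k.+1)) L m).
Proof.
elim: h r => [|h IHh] r hk hc h2 oddpc.
  by apply: eqlim_ext => L m; rewrite bressoud_sum_h0 big_ord0.
have recr (G : nat -> K) : \sum_(a < h.+1 | allowed k.+1 p a) G a =
    \sum_(a < h | allowed k.+1 p a) G a + (if allowed k.+1 p h then G h else 0).
  by rewrite [LHS]big_mkcond big_ord_recr /= -big_mkcond.
case: r hc => [|r] hc; last first.
  have hr : (h + r <= k)%N by lia.
  have hc' : (c + r.+1 = k.+1 + h)%N by lia.
  apply: eqlim_trans (bressoud_sum_rec hr) _.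
  apply: eqlim_trans (eqlimD (IHh r _ hc' _ oddpc) (eqlim_ext (fun _ _ => erefl))) _; try lia.
  apply: eqlim_ext => L m.
  rewrite (recr (fun a => shift a (state_sum k (next_bound k.+1 c p a) (k.+1 + next_bound k.+1 c p a) (p + k.+1)) L m)).
  rewrite ifT; last by rewrite /allowed; lia.
  have -> : next_bound k.+1 c p h = (k - r - h)%N by rewrite /next_bound; lia.
  rewrite /state_sum ifT; last lia.
  by rewrite subnn.
have hk1 : (h <= k.+1)%N by lia.
apply: eqlim_trans (bressoud_sum_rec0 hk1) _.
pose S L m := \sum_(a < h | allowed k.+1 p a)
    shift a (state_sum k (next_bound k.+1 c p a) (k.+1 + next_bound k.+1 c p a) (p + k.+1)) L m.
apply: eqlim_trans (_ : eqlim _ (fun L m => S L m + shift h (bressoud_sum0 k (k.+1 - h)) L m)) _.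
  apply: eqlimD; last exact: eqlim_ext.
  case: (h) hk1 hc h2 @S => [|b] hk1 hc h2 S.
    by apply: eqlim_ext => L m; rewrite bressoud_sum0_h0 /S big_ord0.
  have bk : (b <= k.+1)%N by lia.
  apply: eqlim_trans (bressoud_sum0_unfold bk) _.
  apply: eqlim_ext => L m; apply: eq_big => [a|a _].
    by have := ltn_ord a; rewrite /allowed; lia.
  have ab := ltn_ord a.
  have -> : next_bound k.+1 c p a = (k.+1 - (a + odd (a + b)))%N by rewrite /next_bound; lia.
  by rewrite /state_sum ifF //; lia.
apply: eqlim_ext => L m.
rewrite (recr (fun a => shift a (state_sum k (next_bound k.+1 c p a) (k.+1 + next_bound k.+1 c p a) (p + k.+1)) L m)).
congr (_ + _); case: ifP => [al|]; last first.
  rewrite /allowed => al; have -> : (k.+1 - h = 0)%N by lia.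
  by rewrite /shift bressoud_sum0_h0 mulr0.
rewrite /allowed in al; have E : (next_bound k.+1 c p h = k - h)%N by rewrite /next_bound; lia.
rewrite E /state_sum ifF; last lia.
by rewrite subSn //; lia.
Qed.

Lemma state_sum_rec k b c p : valid k.+1 b c p ->
  eqlim (state_sum k b c p) (fun L m => \sum_(a < b.+1 | allowed k.+1 p a)
    shift a (state_sum k (next_bound k.+1 c p a) (k.+1 + next_bound k.+1 c p a) (p + k.+1)) L m).
Proof.
move=> /and4P[bk bc cb opc]; rewrite {1}/state_sum; case: ifPn => op.
  by apply: bressoud_sum_unfold => //; lia.
apply: eqlim_trans (bressoud_sum0_unfold bk) _.
apply: eqlim_ext => L m; apply: eq_big => [a|a _].
  by have := ltn_ord a; rewrite /allowed; lia.
have ab := ltn_ord a.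
have -> : next_bound k.+1 c p a = (k.+1 - (a + odd (a + b)))%N by rewrite /next_bound; lia.
by rewrite /state_sum ifF //; lia.
Qed.

Lemma state_sum_bound k : exists2 B, 0 <= B &
  forall b c p L m, valid k.+1 b c p -> `|state_sum k b c p L m| <= B.
Proof.
have [B B0 HB] := ag_sum_bound k.
have [W W0 HW] := qtrans_bound w'_geom (ltn0Sn k).
exists (W * B); first exact: mulr_ge0.
move=> b c p L m /and4P[bk bc cb opc].
by rewrite /state_sum; case: ifP => _; apply: HW => // *; rewrite ?HB //; lia.
Qed.

Lemma state_sum_near1 k : exists2 B, 0 <= B & forall b c p L m, valid k.+1 b c p ->
  (0 < L)%N -> `|state_sum k b c p L m - 1| <= B * `|q| ^+ m.
Proof.
have [B B0 HB] := ag_sum_near1 k.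
have [W W0 HW] := qtrans_near1 w'_geom (ltn0Sn k) w'0.
exists (B + W * (B + 1)); first by rewrite addr_ge0 ?mulr_ge0 ?addr_ge0.
move=> b c p L m /and4P[bk bc cb opc] L0.
by rewrite /state_sum; case: ifP => _; apply: HW => // *; rewrite ?HB //; lia.
Qed.

Lemma state_sum_ge1 k b c p L m : 0 <= q -> (forall n, 0 <= w n) ->
  (forall n, 0 <= w' n) -> valid k.+1 b c p -> (0 < L)%N ->
  1 <= state_sum k b c p L m.
Proof.
move=> q0 w_ge0 w'_ge0 /and4P[bk bc cb opc] L0.
by rewrite /state_sum; case: ifP => _; apply: qtrans_ge1 => // *; apply: ag_sum_ge1 => //; lia.
Qed.

End Transform.

(** * The combinatorial recursion and its solution *)

Section Truncation.
Set Implicit Arguments.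
Unset Strict Implicit.
Variable K : numFieldType.
Implicit Types (q : K) (T : nat -> nat -> nat -> nat -> K).

(* Sum over the first [M] entries of the frequency sequences in the state
   [(b, c, p)], the terminal value [T] being evaluated at the final state. *)
Fixpoint walk q k T M b c p m : K :=
  if M is M'.+1 then \sum_(a < b.+1 | allowed k p a)
    q ^+ (m * a) * walk q k T M' (next_bound k c p a) (k + next_bound k c p a) (p + k) m.+1
  else T b c p m.

Definition one_end : nat -> nat -> nat -> nat -> K := fun _ _ _ _ => 1.

(** Terminal values are taken at raise [m + M], so their discrepancy gains a factor that is small
    for large [M]. *)
Lemma walk_dist q k (B : K) T T' M b c p m : 0 <= B ->
  (forall b c p m, valid k b c p -> `|T b c p m - T' b c p m| <= B * `|q| ^+ m) ->
  valid k b c p ->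
  `|walk q k T M b c p m - walk q k T' M b c p m| <=
    walk `|q| k one_end M b c p m * (B * `|q| ^+ (m + M)).
Proof.
move=> B0 TT'; elim: M b c p m => [|M IHM] b c p m v /=.
  by rewrite mul1r addn0 TT'.
rewrite -sumrB (le_trans (ler_norm_sum _ _ _)) // mulr_suml ler_sum // => a al.
rewrite -mulrBr normrM normrX -mulrA ler_wpM2l ?exprn_ge0 //.
by rewrite addnS -addSn IHM // (valid_next _ _ _ _ _ v (ltn_ord a) al).
Qed.

Lemma walk_le q k T T' M b c p m : 0 <= q ->
  (forall b c p m, valid k b c p -> T b c p m <= T' b c p m) ->
  valid k b c p -> walk q k T M b c p m <= walk q k T' M b c p m.
Proof.
move=> q0 TT'; elim: M b c p m => [|M IHM] b c p m v /=; first exact: TT'.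
rewrite ler_sum // => a al; rewrite ler_wpM2l ?exprn_ge0 //.
by rewrite IHM // (valid_next _ _ _ _ _ v (ltn_ord a) al).
Qed.

Lemma walk_eqlim q k (T : nat -> nat -> nat -> nat -> nat -> K) M b c p : `|q| < 1 ->
  (forall b c p, valid k b c p -> eqlim (T b c p) (fun L m =>
     \sum_(a < b.+1 | allowed k p a)
        shift q a (T (next_bound k c p a) (k + next_bound k c p a)%N (p + k)%N) L m)) ->
  valid k b c p ->
  eqlim (T b c p) (fun L => walk q k (fun b c p => T b c p L) M b c p).
Proof.
move=> q1 Trec; elim: M b c p => [|M IHM] b c p v; first exact: eqlim_ext.
apply: eqlim_trans (Trec _ _ _ v) _.
pose X a := shift q a (T (next_bound k c p a) (k + next_bound k c p a)%N (p + k)%N).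
pose Y a := shift q a (fun L => walk q k (fun b c p => T b c p L) M (next_bound k c p a) (k + next_bound k c p a)%N (p + k)%N).
apply: (@eqlim_sum _ b.+1 (allowed k p) X Y) => a ab al.
by apply: shift_eqlim => //; apply: IHM; rewrite (valid_next _ _ _ _ _ v ab al).
Qed.

(** * The reciprocal q-factorials as weights *)

Definition qweight q d n : K := (qpoch (q ^+ d) (q ^+ d) n)^-1.

Lemma qpoch_factor q d n : q ^+ d * (q ^+ d) ^+ n = q ^+ (d * n.+1).
Proof. by rewrite -exprS -exprM. Qed.

Lemma norm_factor_ge q d : `|q| < 1 -> (0 < d)%N -> 1 - `|q| <= `|1 - q ^+ d|.
Proof.
move=> q1 d0; rewrite (le_trans _ (lerB_dist _ _)) // normr1 lerD2l lerN2 normrX.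
by case: d d0 => // d _; rewrite exprS ler_piMr // exprn_ile1 // ltW.
Qed.

Lemma qweight0 q d : qweight q d 0 = 1.
Proof. by rewrite /qweight /qpoch big_ord0 invr1. Qed.

Lemma qweightS q d n : `|q| < 1 -> (0 < d)%N ->
  qweight q d n = qweight q d n.+1 * (1 - q ^+ (d * n.+1)).
Proof.
move=> q1 d0; rewrite /qweight /qpoch big_ord_recr /= qpoch_factor invfM mulfVK //.
rewrite -normr_gt0 (lt_le_trans _ (@norm_factor_ge _ _ q1 _)) ?subr_gt0 //.
by rewrite muln_gt0 d0.
Qed.

Lemma qweight_geom q d : `|q| < 1 -> (0 < d)%N -> geometric (qweight q d).
Proof.
move=> q1 d0; have q1' : 0 < 1 - `|q| by rewrite subr_gt0.
exists (1 - `|q|)^-1; first by rewrite invr_ge0 ltW.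
move=> n; rewrite /qweight normfV exprVn lef_pV2 ?posrE ?exprn_gt0 //.
  elim: n => [|n IHn]; first by rewrite /qpoch big_ord0 normr1.
  rewrite /qpoch big_ord_recr /= normrM exprSr ler_pM ?exprn_ge0 ?(ltW q1') //.
  by rewrite qpoch_factor norm_factor_ge // muln_gt0 d0.
rewrite /qpoch normr_prod prodr_gt0 // => i _.
rewrite qpoch_factor (lt_le_trans q1') // norm_factor_ge // muln_gt0 d0 //.
Qed.

Lemma qweight_ge0 q d n : 0 <= q -> q < 1 -> 0 <= qweight q d n.
Proof.
move=> q0 q1; rewrite invr_ge0 prodr_ge0 // => i _.
by rewrite qpoch_factor subr_ge0 exprn_ile1 // ltW.
Qed.

Hypothesis exprn_small :
  forall x e : K, 0 <= x -> x < 1 -> 0 < e -> exists n, x ^+ n < e.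

Definition bressoud_state q k b c p := state_sum q (qweight q 1) (qweight q 2) k b c p.

Lemma bressoud_state_rec q k b c p : `|q| < 1 -> valid k.+1 b c p ->
  eqlim (bressoud_state q k b c p) (fun L m => \sum_(a < b.+1 | allowed k.+1 p a)
    shift q a (bressoud_state q k (next_bound k.+1 c p a) (k.+1 + next_bound k.+1 c p a)
      (p + k.+1)) L m).
Proof.
move=> q1 v; apply: state_sum_rec => //; try exact: qweight_geom.
  by move=> n; rewrite [LHS](qweightS _ q1) // mul1n.
by move=> n; apply: qweightS.
Qed.

(** For [q >= 0] the multisums are at least 1, so ending the walk with them only enlarges it; but
    that walk approximates a multisum, which is at most [B]. The 1 in [B + 1] is the approximation
    error allowed. *)
Lemma walk_bound q k b c p : 0 <= q -> q < 1 -> valid k.+1 b c p ->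
  exists D, forall M, walk q k.+1 one_end M b c p 0 <= D.
Proof.
move=> q0 q1 v; have q1' : `|q| < 1 by rewrite ger0_norm.
have g d : (0 < d)%N -> geometric (qweight q d) by exact: qweight_geom.
have [B B0 HB] := @state_sum_bound _ exprn_small q q1' _ (g 1%N isT) _ (g 2%N isT) k.
exists (B + 1) => M.
have [L0 HL] := walk_eqlim M q1' (fun b c p => @bressoud_state_rec q k b c p q1') v ltr01.
(* The successor ensures a positive level, where the lower bound 1 is available. *)
have H1 := HL L0.+1 0%N (leqnSn _).
set W := walk q k.+1 (fun b c p => bressoud_state q k b c p L0.+1) M b c p 0 in H1.
have W1 : walk q k.+1 one_end M b c p 0 <= W.
  by apply: walk_le => // b' c' p' m' v'; apply: state_sum_ge1 => // *; rewrite ?qweight0 ?qweight_ge0.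
have W0 : 0 <= W.
  rewrite (le_trans _ W1) //; elim: (M) (b) (c) (p) (0%N) => [|M' IHM] * /=; first exact: ler01.
  by rewrite sumr_ge0 // => a _; rewrite mulr_ge0 ?exprn_ge0.
rewrite (le_trans W1) // -(ger0_norm W0).
rewrite -[W](subKr (bressoud_state q k b c p L0.+1 0)) (le_trans (ler_normB _ _)) //.
by rewrite lerD //; apply: HB.
Qed.

(** Two errors: replacing the terminal multisums by 1 costs at most [D * B * |q|^M], and unfolding
    [M] times costs an error that vanishes in [L] for fixed [M]. Hence [L0] depends on [M]. *)
Lemma bressoud_state_walk q k b c p (e : K) : `|q| < 1 -> valid k.+1 b c p -> 0 < e ->
  exists M0, forall M, (M0 <= M)%N -> exists L0, forall L, (L0 <= L)%N ->
    `|bressoud_state q k b c p L 0 - walk q k.+1 one_end M b c p 0| <= e.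
Proof.
move=> q1 v e0; have e20 : 0 < e / 2 by rewrite divr_gt0.
have g d : (0 < d)%N -> geometric (qweight q d) by exact: qweight_geom.
have [B B0 HB] := @state_sum_near1 _ exprn_small q q1 _ (g 1%N isT) (qweight0 _ _) _ (g 2%N isT) (qweight0 _ _) k.
have [D HD] := @walk_bound `|q| k b c p (normr_ge0 _) q1 v.
have D0 : 0 <= D := le_trans (ler01 : 0 <= (1 : K)) (HD 0%N).
have DB1 : 0 < D * B + 1 by rewrite ltr_wpDl ?mulr_ge0.
have [M0 HM0] := exprn_eventually_small exprn_small (normr_ge0 q) q1 (divr_gt0 e20 DB1).
exists M0 => M MM0.
have [L0 HL] := walk_eqlim M q1 (fun b c p => @bressoud_state_rec q k b c p q1) v e20.
exists L0.+1 => L LL0.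
rewrite (splitr e) (le_trans (ler_distD (walk q k.+1 (fun b c p => bressoud_state q k b c p L) M b c p 0) _ _)) //.
rewrite lerD ?HL //; first exact: ltnW.
rewrite (le_trans (@walk_dist q k.+1 B _ _ M b c p 0 B0 _ v)) //.
  by move=> b' c' p' m' v'; apply: HB => //; apply: leq_trans LL0.
rewrite (@le_trans _ _ (D * (B * `|q| ^+ (0 + M)))) //.
  by rewrite ler_wpM2r // mulr_ge0 ?exprn_ge0.
rewrite mulrA add0n (le_trans (ler_wpM2l _ (HM0 M MM0))) ?mulr_ge0 //.
by rewrite mulrCA ger_pMr // ler_pdivrMr // mul1r lerDl.
Qed.

End Truncation.

(** * Enumeration of frequency sequences and of summation variables *)

Section Paths.
Set Implicit Arguments.
Unset Strict Implicit.

Fixpoint paths k M b c p : seq (seq nat) :=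
  if M is M'.+1 then
    [seq a :: l | a <- [seq a <- index_iota 0 b.+1 | allowed k p a],
       l <- paths k M' (next_bound k c p a) (k + next_bound k c p a) (p + k)]
  else [:: [::]].

Fixpoint path_ok k b c p (l : seq nat) : bool :=
  if l is a :: l' then [&& (a <= b)%N, allowed k p a &
    path_ok k (next_bound k c p a) (k + next_bound k c p a) (p + k) l']
  else true.

Fixpoint path_weight m (l : seq nat) : nat :=
  if l is a :: l' then (m * a + path_weight m.+1 l')%N else 0%N.

Lemma path_weightE m l :
  path_weight m l = (\sum_(i < size l) (m + i) * nth 0%N l i)%N.
Proof.
elim: l m => [|a l IHl] m /=; first by rewrite big_ord0.
rewrite big_ord_recl /= addn0 IHl; congr (_ + _)%N.
by apply: eq_bigr => i _; rewrite /bump addnA addn1.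
Qed.

Lemma walk_paths (K : numFieldType) (q : K) k M b c p m :
  walk q k (@one_end K) M b c p m = \sum_(l <- paths k M b c p) q ^+ path_weight m l.
Proof.
elim: M b c p m => [|M IHM] b c p m; first by rewrite big_seq1 expr0.
rewrite [LHS]/= big_flatten big_map big_filter big_mkord; apply: eq_bigr => a _.
by rewrite big_map IHM mulr_sumr; apply: eq_bigr => l _; rewrite exprD.
Qed.

Lemma mem_paths k M b c p l :
  (l \in paths k M b c p) = (size l == M) && path_ok k b c p l.
Proof.
elim: M b c p l => [|M IHM] b c p l; first by rewrite inE; case: l.
apply/allpairsPdep/idP => [[a [l' [+ + ->]]]|].
  rewrite mem_filter mem_index_iota IHM /= eqSS ltnS => /andP[-> ab] /andP[-> ->].
  by rewrite ab.
case: l => [|a l] //; move=> /andP[sl /and3P[ab al ok]]; rewrite /= eqSS in sl.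
by exists a, l; rewrite mem_filter mem_index_iota al ltnS ab IHM sl.
Qed.

Lemma paths_uniq k M b c p : uniq (paths k M b c p).
Proof.
elim: M b c p => [|M IHM] b c p //; apply: allpairs_uniq_dep.
- by rewrite filter_uniq // iota_uniq.
- by move=> *; exact: IHM.
- by move=> [a l] [a' l'] _ _ /= [-> ->].
Qed.

Lemma path_okP k b c p l : (0 < k)%N -> valid k b c p ->
  reflect [/\ nth 0%N l 0 <= b, (nth 0%N l 0).*2 + nth 0%N l 1 <= c &
    forall i, nth 0%N l i + nth 0%N l i.+1 <= k /\
      (nth 0%N l i + nth 0%N l i.+1 = k ->
       odd (i * nth 0%N l i + i.+1 * nth 0%N l i.+1) = odd p)]%N
  (path_ok k b c p l).
Proof.
move=> k0; elim: l b c p => [|a l IHl] b c p v /=.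
  (* Beyond the end all entries are 0, and [0 < k] keeps two of them from summing to [k]. *)
  by apply: ReflectT; split=> // i; rewrite !nth_nil; split=> // E; move: k0; rewrite -E.
(* Renumbering changes the weighted sum by [f_i + f_{i+1}], which is [k] where the congruence
   applies; hence [p] becomes [p + k]. *)
have step i : odd (i.+1 * nth 0%N l i + i.+2 * nth 0%N l i.+1) =
    odd (i * nth 0%N l i + i.+1 * nth 0%N l i.+1) (+) odd (nth 0%N l i + nth 0%N l i.+1).
  by rewrite -oddD; congr odd; ring.
case: (boolP (a <= b)%N) => ab; last by apply: ReflectF; case=> h; case/negP: ab.
case: (boolP (allowed k p a)) => al; last first.
  apply: ReflectF; case => _ _ /(_ 0%N) /= []; move: al; rewrite /allowed mul0n mul1n; lia.
have v' := valid_next _ _ _ _ _ v ab al.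
have := v; rewrite /valid => /and4P[bk bc cb _].
apply: (iffP (IHl _ _ _ v')) => -[H0 H1 H].
  have [h1 h2] : (nth 0%N l 0 <= k - (a + odd (k + a + p)) /\ nth 0%N l 0 <= c - a.*2)%N.
    by move: H0; rewrite /next_bound leq_min => /andP.
  rewrite /allowed in al; split=> //; first lia.
  case=> [|i] /=; first by rewrite mul0n mul1n; split; lia.
  have [Hle Hpar] := H i; split=> // E; rewrite step Hpar // E; lia.
have [Hk Hp] := H 0%N; rewrite /= mul0n mul1n in Hk Hp.
have [Hk1 _] := H 1%N; rewrite /= in Hk1.
have H0' : (nth 0%N l 0 <= next_bound k c p a)%N.
  by rewrite /next_bound leq_min; move: H1; rewrite /allowed /= in al *; lia.
split=> //; first lia.
move=> i; have [Hle Hpar] := H i.+1; split=> // E.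
by have := Hpar E; rewrite /= step E; lia.
Qed.

End Paths.

(** * Truncated multisums as sums over finite boxes *)

Section Box.
Set Implicit Arguments.
Unset Strict Implicit.

(* The sequences s_1 >= ... >= s_k >= 0 whose gaps s_i - s_{i+1}, as well as s_k,
   are less than [L]. *)
Fixpoint box L k : seq (seq nat) :=
  if k is k'.+1 then
    [seq rcons [seq (n + x)%N | x <- t] n | n <- index_iota 0 L, t <- box L k']
  else [:: [::]].

Lemma size_box L k s : s \in box L k -> size s = k.
Proof.
elim: k s => [|k IHk] s /=; first by rewrite inE => /eqP ->.
by move=> /allpairsP[[n t] [_ /= /IHk st ->]]; rewrite size_rcons size_map st.
Qed.

Lemma box_uniq L k : uniq (box L k).
Proof.
elim: k => //= k IHk; apply: allpairs_uniq => //; first exact: iota_uniq.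
move=> [n t] [n' t'] _ _ /= /rcons_inj[+ En]; rewrite -{}En => /(inj_map _) -> //.
by move=> x y /addnI.
Qed.

Lemma nth_box_rcons n t i : (i <= size t)%N ->
  nth 0%N (rcons [seq (n + x)%N | x <- t] n) i = (n + nth 0%N t i)%N.
Proof.
rewrite nth_rcons size_map leq_eqVlt => /orP[/eqP->|it].
  by rewrite ltnn eqxx nth_default ?addn0.
by rewrite it (nth_map 0%N).
Qed.

Lemma sorted_box L k s : s \in box L k -> sorted geq s.
Proof.
elim: k s => [|k IHk] s /=; first by rewrite inE => /eqP ->.
move=> /allpairsP[[n t] [_ /= /IHk st ->]].
have -> : rcons [seq (n + x)%N | x <- t] n = [seq (n + x)%N | x <- rcons t 0%N].
  by rewrite map_rcons addn0.
rewrite sorted_map; case: t st => //= x t; rewrite rcons_path => xt.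
rewrite (eq_path (e' := geq)); last by move=> a b /=; rewrite leq_add2l.
by rewrite xt /= leq_add2l.
Qed.

Lemma box_sub L L' k : (L <= L')%N -> {subset box L k <= box L' k}.
Proof.
move=> LL'; elim: k => // k IHk s /allpairsP[[n t] [nL /= tb ->]].
apply/allpairsP; exists (n, t); split=> //; last exact: IHk.
by move: nL; rewrite !mem_index_iota /=; lia.
Qed.

Lemma mem_box L k s : size s = k -> sorted geq s ->
  (forall x, x \in s -> (x < L)%N) -> s \in box L k.
Proof.
elim: k s => [|k IHk] s; first by move/size0nil ->.
case/lastP: s => // s n; rewrite size_rcons => -[sk] srt sL.
have geq_trans : transitive geq by move=> a b c /= ab bc; apply: leq_trans bc ab.
have ns x : x \in s -> (n <= x)%N.
  move: srt; rewrite -cats1 sorted_pairwise // pairwise_cat => /and3P[+ _ _].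
  by move=> /allrelP H xs; apply: H; rewrite ?inE.
have E : s = [seq (n + x)%N | x <- [seq (x - n)%N | x <- s]].
  rewrite -map_comp -[LHS]map_id; apply/eq_in_map => x xs /=.
  by rewrite subnKC // ns.
apply/allpairsP; exists (n, [seq (x - n)%N | x <- s]); split => /=.
- by rewrite mem_index_iota /= sL // mem_rcons inE eqxx.
- apply: IHk; first by rewrite size_map.
    rewrite sorted_map; move: srt; rewrite -cats1 => /cat_sorted2[+ _].
    by apply: sub_sorted => a b /=; apply: leq_sub2r.
  move=> x /mapP[y ys ->]; have : (y < L)%N by rewrite sL // mem_rcons inE ys orbT.
  by apply: leq_ltn_trans; rewrite leq_subr.
- by rewrite -E.
Qed.

(** Pairing each subtracted part with its own square keeps the subtraction in [nat] exact, as
    [x <= x * x]. The extra [s_k] is left to [box_term]. *)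
Definition box_exp k j r m (s : seq nat) : nat :=
  \sum_(i < k) (nth 0 s i * (nth 0 s i + m) + (k - r <= i) * nth 0 s i
                - (i < j) * nth 0 s i)%N.

Variable K : numFieldType.
Implicit Types (q : K) (w : nat -> K).

Definition box_term q w w' k j r m e s : K :=
  q ^+ (box_exp k.+1 j r m s + e * nth 0 s k)%N *
  ((\prod_(i < k) w (nth 0 s i - nth 0 s i.+1)%N) * w' (nth 0 s k)).

(** The exponent identity behind [qtrans]. Removing the last part turns [r] into [r.-1] because that
    part is among the last [r] ones. *)
Lemma box_exp_rcons k j r m n t : (j + r <= k.+1)%N -> size t = k ->
  box_exp k.+1 j r m (rcons [seq (n + x)%N | x <- t] n) =
  (k.+1 * (n * n + m * n) + r * n - j * n
   + box_exp k (minn j k) r.-1 (m + n.*2) t)%N.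
Proof.
move=> jr st; rewrite /box_exp big_ord_recr /= nth_box_rcons ?st // nth_default ?st // addn0.
have E (i : 'I_k) : true -> 
  (nth 0 (rcons [seq (n + x)%N | x <- t] n) i * (nth 0 (rcons [seq (n + x)%N | x <- t] n) i + m)
   + (k.+1 - r <= i) * nth 0 (rcons [seq (n + x)%N | x <- t] n) i
   - (i < j) * nth 0 (rcons [seq (n + x)%N | x <- t] n) i =
  (n * (n + m) + (k.+1 - r <= i) * n - (i < j) * n) + 
  (nth 0 t i * (nth 0 t i + (m + n.*2)) + (k - r.-1 <= i) * nth 0 t i
                - (i < minn j k) * nth 0 t i))%N.
  move=> _; have ik := ltn_ord i; have ik' := ltnW ik; rewrite nth_box_rcons ?st //.
  have -> : (k - r.-1 <= i)%N = (k.+1 - r <= i)%N by lia.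
  have -> : (i < minn j k)%N = (i < j)%N by lia.
  move: (nth 0%N t i) => x.
  have hn : (n <= n * n)%N by case: (n) => // n'; rewrite leq_pmulr.
  have hx : (x <= x * x)%N by case: (x) => // x'; rewrite leq_pmulr.
  rewrite -addnn; case: (k.+1 - r <= i)%N; case: (i < j)%N; rewrite ?mul1n ?mul0n; nia.
rewrite (eq_bigr _ E) big_split /= addnAC; congr (_ + _)%N.
(* Stated for partial sums to allow induction; only [l = k.+1] is used. *)
have S l : (l <= k.+1)%N -> (\sum_(i < l) (n * (n + m) + (k.+1 - r <= i) * n - (i < j) * n) =
   l * (n * n + m * n) + (l - (k.+1 - r)) * n - minn l j * n)%N.
  elim: l => [|l IHl] lk; first by rewrite big_ord0 min0n.
  rewrite big_ord_recr /= IHl; last lia.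
  have hn : (n <= n * n)%N by case: (n) => // n'; rewrite leq_pmulr.
  have hl : (l * n <= l * (n * n))%N by rewrite leq_mul.
  have hm : (minn l j * n <= l * n)%N by rewrite leq_mul // geq_minl.
  case: (leqP (k.+1 - r) l) => h1.
    have -> : (l.+1 - (k.+1 - r) = (l - (k.+1 - r)).+1)%N by lia.
    case: (ltnP l j) => h2; first lia.
    have -> : minn l.+1 j = minn l j by lia.
    rewrite /=; lia.
  have -> : (l.+1 - (k.+1 - r) = 0)%N by lia.
  have -> : (l - (k.+1 - r) = 0)%N by lia.
  case: (ltnP l j) => h2.
    have -> : minn l.+1 j = (minn l j).+1 by lia.
    rewrite /=; lia.
  have -> : minn l.+1 j = minn l j by lia.
  rewrite /=; lia.
have := S k.+1 (leqnn _); rewrite big_ord_recr /= => ->.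
by congr (_ + _ * _ - _ * _)%N; lia.
Qed.

End Box.

Section BoxSum.
Set Implicit Arguments.
Unset Strict Implicit.
Variable K : numFieldType.
Implicit Types (q : K) (w : nat -> K).

Lemma qtrans_box q w w' k h r c x L m : (h + r <= k.+1)%N ->
  (forall m', x L m' = \sum_(t <- box L k) q ^+ box_exp k (minn h k) r.-1 m' t *
     \prod_(i < k) w (nth 0 t i - nth 0 t i.+1)%N) ->
  qtrans q w' k.+1 h (r + c) x L m = \sum_(s <- box L k.+1) box_term q w w' k h r m c s.
Proof.
move=> hr xE; rewrite big_flatten big_map big_mkord; apply: eq_bigr => n _.
rewrite big_map xE mulr_sumr big_seq [RHS]big_seq; apply: eq_bigr => t /size_box st.
rewrite /box_term box_exp_rcons //.
under [X in _ = _ * (X * _)]eq_bigr => i _.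
  rewrite !nth_box_rcons ?st ?(ltnW (ltn_ord i)) // subnDl; over.
rewrite !nth_box_rcons ?st // nth_default ?st // addn0.
have -> : (k.+1 * (n * n + m * n) + r * n - h * n + box_exp k (minn h k) r.-1 (m + n.*2) t + c * n
  = k.+1 * (n * n + m * n) + (r + c) * n - h * n + box_exp k (minn h k) r.-1 (m + n.*2) t)%N.
  have := @qtrans_exponent_le k.+1 h r m n; lia.
by rewrite exprD; ring.
Qed.

Lemma ag_sum_box q w k h r L m : (h + r <= k)%N ->
  ag_sum q w k h.+1 r L m = \sum_(t <- box L k) q ^+ box_exp k h r m t *
     \prod_(i < k) w (nth 0 t i - nth 0 t i.+1)%N.
Proof.
elim: k h r m => [|k IHk] h r m hr.
  by rewrite big_seq1 /box_exp !big_ord0 mulr1.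
rewrite /= -[r in qtrans _ _ _ _ r](addn0 r) (@qtrans_box _ w) //; last first.
  move=> m'; have -> : minn h.+1 k.+1 = (minn h k).+1 by lia.
  by apply: IHk; lia.
rewrite big_seq [RHS]big_seq; apply: eq_bigr => t /size_box st.
by rewrite /box_term mul0n addn0 big_ord_recr /= [nth 0%N t k.+1]nth_default ?st // subn0.
Qed.

Lemma state_sum_box q w w' k j r L : (j + r <= k.+1)%N ->
  state_sum q w w' k j (k.+1 + j - r) (k.+1 + r - j + 1) L 0 =
  \sum_(s <- box L k.+1) box_term q w w' k j r 0 1 s.
Proof.
move=> jr; rewrite /state_sum ifT; last lia.
have -> : (k.+1 + j - (k.+1 + j - r) = r)%N by lia.
rewrite /bressoud_sum /= -(addn1 r) -(@qtrans_box _ w _ _ _ _ _ (ag_sum q w k (minn j.+1 k.+1) r.-1)) // => m'.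
have -> : minn j.+1 k.+1 = (minn j k).+1 by lia.
by apply: ag_sum_box; lia.
Qed.

Lemma multisum_exponentE k j r s : (j + r <= k.+1)%N ->
  multisum_exponent k.+1 j r s = (box_exp k.+1 j r 0 s + nth 0 s k)%N%:Z.
Proof.
move=> jr; rewrite /multisum_exponent PoszD; congr (_ + _).
rewrite !big_add1 /= !big_mkord /box_exp (big_morph Posz PoszD (erefl _)).
rewrite (big_ord_widen k.+1 (fun i => (part s i.+1)%:Z)); last lia.
rewrite (big_mkcond (fun i : 'I_ _ => (i < j)%N)) /=.
have -> : \sum_(k.+1 - r <= i < k.+1) (part s i.+1)%:Z =
    \sum_(i < k.+1) (if (k.+1 - r <= i)%N then (part s i.+1)%:Z else 0).
  rewrite -(big_mkord xpredT (fun i => if (k.+1 - r <= i)%N then (part s i.+1)%:Z else 0)).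
  rewrite [RHS](@big_cat_nat _ _ _ (k.+1 - r)) ?leq_subr //=.
  rewrite [X in _ = X + _]big_nat [X in _ = X + _]big1; last first.
    by move=> i /andP[_]; rewrite ltnNge => /negbTE ->.
  by rewrite add0r; apply: eq_big_nat => i /andP[-> _].
rewrite -sumrB -big_split /=; apply: eq_bigr => i _; rewrite /part /= addn0.
move: (nth 0%N s i) => x; have hx : (x <= x * x)%N by case: (x) => // x'; rewrite leq_pmulr.
case: (i < j)%N; case: (k.+1 - r <= i)%N; rewrite ?mul1n ?mul0n ?subn0; lia.
Qed.

Lemma multisum_termE q k j r s : (j + r <= k.+1)%N ->
  multisum_term q k.+1 j r s = box_term q (qweight q 1) (qweight q 2) k j r 0 1 s.
Proof.
move=> jr; rewrite /multisum_term multisum_exponentE // /box_term mul1n.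
congr (_ * _); rewrite invfM /qweight expr1; congr (_ * _).
by rewrite big_add1 /= big_mkord -prodfV.
Qed.

Lemma norm_box_term q w w' k j r m c s : `|box_term q w w' k j r m c s| =
  box_term `|q| (fun n => `|w n|) (fun n => `|w' n|) k j r m c s.
Proof. by rewrite /box_term !normrM normrX normr_prod. Qed.

Lemma valid_start k j r : (j + r <= k)%N -> valid k j (k + j - r) (k + r - j + 1).
Proof. by rewrite /valid; lia. Qed.

Hypothesis exprn_small :
  forall x e : K, 0 <= x -> x < 1 -> 0 < e -> exists n, x ^+ n < e.

(** Absolute values give the same multisum at [|q|] with weights [|w|]; geometric growth of these
    weights is all that [state_sum_bound] asks of them. *)
Lemma multisum_norm_bound q k j r : `|q| < 1 -> (j + r <= k.+1)%N ->
  exists C, forall L, \sum_(s <- box L k.+1) `|multisum_term q k.+1 j r s| <= C.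
Proof.
move=> q1 jr; have t1 : Num.norm (Num.norm q) < 1 by rewrite normr_id.
have g d : (0 < d)%N -> geometric (fun n => `|qweight q d n|).
  move=> d0; have [rho rho0 H] := qweight_geom q1 d0.
  by exists rho => // n; rewrite normr_id.
have [B B0 HB] := @state_sum_bound _ exprn_small _ t1 _ (g 1%N isT) _ (g 2%N isT) k.
exists B => L; rewrite (eq_bigr _ (fun s _ => congr1 Num.norm (multisum_termE _ _ jr))).
rewrite (eq_bigr _ (fun s _ => norm_box_term _ _ _ _ _ _ _ _ _)) -state_sum_box //.
rewrite -[leLHS]ger0_norm; first exact/HB/valid_start.
rewrite state_sum_box // sumr_ge0 // => s _.
by rewrite /box_term !mulr_ge0 ?exprn_ge0 ?prodr_ge0.
Qed.

End BoxSum.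

(** * Unconditional sums along an exhausting chain *)

Section Chain.
Set Implicit Arguments.
Unset Strict Implicit.
Variables (R : realType) (I : choiceType) (A : nat -> seq I).
Hypothesis A_uniq : forall M, uniq (A M).
Hypothesis A_mono : forall M N, (M <= N)%N -> {subset A M <= A N}.

Lemma sum_subset (V : nmodType) (s t : seq I) (g : I -> V) :
  uniq s -> uniq t -> {subset s <= t} ->
  \sum_(i <- t) g i = \sum_(i <- s) g i + \sum_(i <- t | i \notin s) g i.
Proof.
move=> us ut st; rewrite (bigID (mem s)) /=; congr (_ + _).
rewrite -big_filter; apply: perm_big; apply: uniq_perm => //.
  exact: filter_uniq.
by move=> i; rewrite mem_filter andbC; apply/andP/idP => [[]//|i_s]; split; rewrite ?st.
Qed.

Lemma real_chain (g : I -> R) C : (forall i, 0 <= g i) ->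
  (forall M, \sum_(i <- A M) g i <= C) ->
  exists s, forall e, 0 < e -> exists M0, forall M, (M0 <= M)%N ->
    `|\sum_(i <- A M) g i - s| <= e.
Proof.
move=> g0 gC; pose E := [set x | exists M, x = \sum_(i <- A M) g i]%classic.
have supE : has_sup E.
  split; first by exists (\sum_(i <- A 0%N) g i); exists 0%N.
  by exists C => _ [M ->].
exists (sup E) => e e0; have [_ [M0 ->] HM0] := sup_adherent e0 supE.
exists M0 => M MM0; have le1 : \sum_(i <- A M) g i <= sup E.
  by apply: sup_upper_bound => //; exists M.
have le2 : \sum_(i <- A M0) g i <= \sum_(i <- A M) g i.
  by rewrite (sum_subset g (A_uniq M0) (A_uniq M) (A_mono MM0)) lerDl sumr_ge0.
by rewrite ler_norml; lra.
Qed.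

Lemma gt0_complexE (e : R[i]) : 0 < e -> exists2 r : R, 0 < r & e = r%:C.
Proof.
move=> e0; exists (complex.Re e); last by rewrite RRe_real // gtr0_real.
by rewrite -ltcR RRe_real // gtr0_real.
Qed.

Definition rnorm (z : R[i]) : R := complex.Re `|z|.

Lemma rnormE z : (rnorm z)%:C = `|z|.
Proof. by rewrite /rnorm RRe_real // normr_real. Qed.

Lemma sum_realc (s : seq I) (P : pred I) (g : I -> R) :
  (\sum_(i <- s | P i) g i)%:C = \sum_(i <- s | P i) (g i)%:C.
Proof. exact: rmorph_sum. Qed.

Lemma sum_rnorm_le (u : I -> R[i]) C : (forall M, \sum_(i <- A M) `|u i| <= C) ->
  forall M, \sum_(i <- A M) rnorm (u i) <= complex.Re C.
Proof.
move=> uC M; have CR : C \is Num.real.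
  by rewrite ger0_real // (le_trans _ (uC M)) // sumr_ge0.
by rewrite -lecR sum_realc RRe_real // (eq_bigr _ (fun i _ => rnormE (u i))).
Qed.

Lemma rnorm_Re (z : R[i]) : `|complex.Re z| <= rnorm z.
Proof. by rewrite -lecR rnormE normc_ge_Re. Qed.

Lemma rnorm_Im (z : R[i]) : `|complex.Im z| <= rnorm z.
Proof.
have := rnorm_Re (z * 'i%C); rewrite ReiNIm normrN => /le_trans; apply.
by rewrite -lecR !rnormE normrM complexiE normCi mulr1.
Qed.

(** Writes [g] as the difference of the non-negative families [h] and [h - g], whose sums are
    bounded by [C] and [2 * C]. *)
Lemma real_chain_abs (g h : I -> R) C : (forall i, `|g i| <= h i) ->
  (forall M, \sum_(i <- A M) h i <= C) ->
  exists s, forall e, 0 < e -> exists M0, forall M, (M0 <= M)%N ->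
    `|\sum_(i <- A M) g i - s| <= e.
Proof.
move=> gh hC; have h0 i : 0 <= h i := le_trans (normr_ge0 _) (gh i).
have gh' i : - h i <= g i <= h i by rewrite -ler_norml.
have [s Hs] := real_chain h0 hC.
have [|M|s' Hs'] := @real_chain (fun i => h i - g i) (2 * C).
- by move=> i; have := gh' i; lra.
- rewrite mulr_natl mulr2n (le_trans _ (lerD (hC M) (hC M))) // -big_split /= ler_sum // => i _.
  by have := gh' i; lra.
exists (s - s') => e e0; have e20 : 0 < e / 2 by rewrite divr_gt0.
have [M1 H1] := Hs _ e20; have [M2 H2] := Hs' _ e20.
exists (maxn M1 M2) => M; rewrite geq_max => /andP[m1 m2].
have := H1 _ m1; have := H2 _ m2; rewrite sumrB !ler_norml; lra.
Qed.

Lemma complex_chain (u : I -> R[i]) C :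
  (forall M, \sum_(i <- A M) `|u i| <= C) ->
  exists S, forall e : R[i], 0 < e -> exists M0, forall M, (M0 <= M)%N ->
    `|\sum_(i <- A M) u i - S| <= e.
Proof.
move=> /sum_rnorm_le uC.
have [a Ha] := real_chain_abs (fun i => rnorm_Re (u i)) uC.
have [b Hb] := real_chain_abs (fun i => rnorm_Im (u i)) uC.
exists (a%:C + 'i%C * b%:C) => _ /gt0_complexE[e e0 ->].
have e20 : 0 < e / 2 by rewrite divr_gt0.
have [M1 H1] := Ha _ e20; have [M2 H2] := Hb _ e20.
exists (maxn M1 M2) => M; rewrite geq_max => /andP[m1 m2].
rewrite (eq_bigr _ (fun i _ => complexE (u i))) big_split /= -mulr_sumr -!sum_realc.
rewrite opprD addrACA -mulrBr -!rmorphB (le_trans (ler_normD _ _)) //.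
have -> : e%:C = (e / 2)%:C + (e / 2)%:C by rewrite -rmorphD -splitr.
rewrite normrM complexiE normCi mul1r lerD //.
  by rewrite -rnormE lecR (le_trans _ (H1 _ m1)) // /rnorm normc_def /= expr0n addr0 sqrtr_sqr.
by rewrite -rnormE lecR (le_trans _ (H2 _ m2)) // /rnorm normc_def /= expr0n addr0 sqrtr_sqr.
Qed.

Lemma has_sum_chain (D : set I) (u : I -> R[i]) S C :
  (forall M i, i \in A M -> D i) ->
  (forall i, D i -> exists M, i \in A M) ->
  (forall M, \sum_(i <- A M) `|u i| <= C) ->
  (forall e : R[i], 0 < e -> exists M0, forall M, (M0 <= M)%N ->
    `|\sum_(i <- A M) u i - S| <= e) ->
  has_sum D u S.
Proof.
move=> AD DA /sum_rnorm_le uC uS e e0.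
have e30 : 0 < e / 3 by rewrite divr_gt0.
have [s Hs] := real_chain (fun i => le_trans (normr_ge0 _) (rnorm_Re (u i))) uC.
(* Half of [e / 3], so that the sums of norms at any two levels beyond [M1] differ by at most
   [e / 3]. *)
have [M1 H1] := Hs _ (divr_gt0 e30 (ltr0n _ 2)).
have [|M2 H2] := uS (e / 3)%:C; first by rewrite ltcR.
pose M := maxn M1 M2; exists [fset i in A M]%fset; split.
  by move=> i; rewrite inE => /AD.
move=> B AB BD.
(* The finite set [B] lies in some link of the chain, so its terms outside [A M] are part of a small
   tail. *)
have [N MN BN] : exists2 N, (M <= N)%N & {subset enum_fset B <= A N}.
  have : {in enum_fset B, forall i, D i} := BD.
  elim: (enum_fset B) => [|i t IHt] tD; first by exists M.
  have [|N1 MN1 H] := IHt; first by move=> x xt; apply: tD; rewrite inE xt orbT.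
  have [N2 iN2] := DA i (tD i (mem_head _ _)).
  exists (maxn N1 N2); first by rewrite leq_max MN1.
  move=> x; rewrite inE => /orP[/eqP->|/H xN1].
    exact: A_mono (leq_maxr _ _) _ iN2.
  exact: A_mono (leq_maxl _ _) _ xN1.
have AB' : {subset A M <= B} by move=> i iA; apply: (fsubsetP AB); rewrite inE.
have tail : \sum_(i <- A N | i \notin A M) rnorm (u i) <= e / 3.
  have := sum_subset (rnorm \o u) (A_uniq M) (A_uniq N) (A_mono MN) => /=.
  have := H1 M (leq_maxl _ _); have := H1 N (leq_trans (leq_maxl _ _) MN).
  by rewrite !ler_norml; lra.
rewrite (sum_subset u (A_uniq M) (fset_uniq B) AB') addrAC.
rewrite (le_lt_trans (ler_normD _ _)) //.
have -> : e%:C = (e / 3)%:C + ((e / 3)%:C + (e / 3)%:C).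
  by rewrite -!rmorphD; congr _%:C; field.
rewrite ler_ltD ?H2 ?leq_maxr // (@le_lt_trans _ _ (e / 3)%:C) //; last first.
  by rewrite ltrDl ltcR.
rewrite (le_trans (ler_norm_sum _ _ _)) // (@le_trans _ _ (\sum_(i <- A N | i \notin A M) rnorm (u i))%:C) ?lecR //.
rewrite sum_realc [leRHS](eq_bigr _ (fun i _ => rnormE (u i))).
rewrite -[X in X <= _]big_filter -[X in _ <= X]big_filter.
rewrite (@sum_subset _ [seq i <- B | i \notin A M] [seq i <- A N | i \notin A M]) ?filter_uniq ?fset_uniq //.
  by rewrite lerDl sumr_ge0.
by move=> i; rewrite !mem_filter => /andP[-> /BN].
Qed.

End Chain.

(** Discharges the Archimedean hypothesis [exprn_small] by a Bernoulli-type inequality. *)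
Lemma exprn_small_complex (R : realType) (x e : R[i]) : 0 <= x -> x < 1 -> 0 < e ->
  exists n, x ^+ n < e.
Proof.
move=> x0 x1 /gt0_complexE[d d0 ->].
have xr : x = (complex.Re x)%:C by rewrite RRe_real // ger0_real.
move: x0 x1; rewrite xr ler0c -[1]/(1%:C) ltcR; move: (complex.Re x) => r r0 r1.
have bern n : r ^+ n * (1 + n%:R * (1 - r)) <= 1.
  elim: n => [|n IHn]; first by rewrite mul0r addr0 mulr1.
  rewrite (le_trans _ IHn) // exprSr -mulrA ler_wpM2l ?exprn_ge0 //.
  have : 0 <= n.+1%:R * (1 - r) ^+ 2 by rewrite mulr_ge0 ?sqr_ge0.
  by rewrite -natr1 expr2; nra.
have dr : 0 < d * (1 - r) by rewrite mulr_gt0 // subr_gt0.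
have [n Hn] : exists n, (d * (1 - r))^-1 < n%:R.
  by exists (Num.bound (d * (1 - r))^-1); rewrite archi_boundP // invr_ge0 ltW.
exists n; rewrite -rmorphXn ltcR.
have nd : 1 < n%:R * (1 - r) * d.
  by move: Hn; rewrite -[X in X < _]mul1r ltr_pdivrMr // mulrA mulrAC.
have h : 1 < (1 + n%:R * (1 - r)) * d by rewrite mulrDl mul1r ltr_wpDl // ltW.
have p : 0 < 1 + n%:R * (1 - r).
  by rewrite ltr_pwDl // mulr_ge0 // subr_ge0 ltW.
rewrite -(ltr_pM2r p) (le_lt_trans (bern n)) //; by rewrite mulrC.
Qed.

(** * The two sides of the identity *)

Section Chains.
Set Implicit Arguments.
Unset Strict Implicit.

Definition fs_of (l : seq nat) : frequency_sequence :=
  [fsfun i in [fset i in iota 0 (size l)]%fset => nth 0%N l i | 0%N].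

Lemma fs_ofE l i : fs_of l i = nth 0%N l i.
Proof.
rewrite fsfun_fun inE mem_iota /= add0n.
by case: ltnP => // li; rewrite nth_default.
Qed.

Lemma freq_size_fs_of l : freq_size (fs_of l) = path_weight 0 l.
Proof.
rewrite /freq_size path_weightE.
rewrite (@big_fset_incl _ _ _ _ _ [fset i in iota 0 (size l)]%fset); first last.
- by move=> i _; rewrite mem_finsupp negbK => /eqP ->; rewrite muln0.
- apply/fsubsetP => i; rewrite mem_finsupp fs_ofE inE mem_iota /= add0n.
  by case: ltnP => // li; rewrite nth_default.
rewrite -(big_mkord xpredT (fun i => (0 + i) * nth 0 l i)%N) /index_iota subn0.
rewrite (perm_big (iota 0 (size l))) /=.
  by apply: eq_bigr => i _; rewrite fs_ofE.
apply: uniq_perm; rewrite ?fset_uniq ?iota_uniq // => i.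
by rewrite !inE.
Qed.

Definition freq_chain k b c p M : seq frequency_sequence :=
  [seq fs_of l | l <- paths k M b c p].

Lemma freq_chain_uniq k b c p M : uniq (freq_chain k b c p M).
Proof.
rewrite map_inj_in_uniq ?paths_uniq // => l l'.
rewrite !mem_paths => /andP[/eqP sl _] /andP[/eqP sl' _] E.
apply: (@eq_from_nth _ 0%N); first by rewrite sl sl'.
by move=> i _; rewrite -!fs_ofE E.
Qed.

(** Condition (ii) splits along the maximum into two linear bounds, which gives the initial state of
    the walk. *)
Lemma admissibleE k j r (f : frequency_sequence) : (j + r <= k)%N ->
  admissible k j r f <->
  [/\ f 0 <= j, (f 0).*2 + f 1 <= k + j - r &
    forall i, f i + f i.+1 <= k /\ (f i + f i.+1 = k ->
       odd (i * f i + i.+1 * f i.+1) = odd (k + r - j + 1))]%N.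
Proof.
move=> jr; split=> [[H1 H2 H3]|[H1 H2 H3]].
  have [h1 h2] : (f 0 <= j /\ (f 0).*2 + f 1 <= k + j - r)%N by lia.
  split=> // i; split=> // /H3 E; lia.
split=> [i||i /(proj2 (H3 i)) E]; [by case: (H3 i) | lia | lia].
Qed.

Lemma mem_freq_chain k j r M (f : frequency_sequence) : (0 < k)%N -> (j + r <= k)%N ->
  f \in freq_chain k j (k + j - r) (k + r - j + 1) M <->
  admissible k j r f /\ forall i, (M <= i)%N -> f i = 0%N.
Proof.
move=> k0 jr; rewrite admissibleE //; split.
  move=> /mapP[l + ->]; rewrite mem_paths => /andP[/eqP sl].
  move=> /(path_okP _ k0 (valid_start jr))[H1 H2 H3]; split.
    by split=> [||i]; rewrite !fs_ofE.
  by move=> i Mi; rewrite fs_ofE nth_default // sl.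
move=> [[H1 H2 H3] H0]; pose l := mkseq f M.
have lE i : nth 0%N l i = f i.
  have [iM|Mi] := ltnP i M; first by rewrite nth_mkseq.
  by rewrite nth_default ?size_mkseq // H0.
apply/mapP; exists l; last by apply/fsfunP => i; rewrite fs_ofE lE.
rewrite mem_paths size_mkseq eqxx; apply/(path_okP _ k0 (valid_start jr)).
by split=> [||i]; rewrite !lE.
Qed.

Lemma freq_bound (f : frequency_sequence) :
  exists M, forall i, (M <= i)%N -> f i = 0%N.
Proof.
exists (\max_(i <- finsupp f) i).+1 => i Mi; apply/eqP; rewrite -[_ == _]negbK.
rewrite -mem_finsupp; apply/negP => fi.
by move: Mi; rewrite ltnNge (@leq_bigmax_seq _ _ xpredT id).
Qed.

Definition tuple_chain k L : seq (k.-tuple nat) := pmap insub (box L k).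

Lemma mem_tuple_chain k L (s : k.-tuple nat) :
  (s \in tuple_chain k L) = (tval s \in box L k).
Proof. by rewrite mem_pmap_sub. Qed.

Lemma tuple_chain_uniq k L : uniq (tuple_chain k L).
Proof. exact/pmap_sub_uniq/box_uniq. Qed.

Lemma sum_tuple_chain (V : nmodType) k L (g : seq nat -> V) :
  \sum_(s <- tuple_chain k L) g s = \sum_(s <- box L k) g s.
Proof.
have : all [pred s | size s == k] (box L k).
  by apply/allP => s /size_box /= ->.
rewrite /tuple_chain; elim: (box L k) => [|s t IHt] /=; first by rewrite !big_nil.
by case/andP => sk tk; rewrite insubT /= !big_cons IHt.
Qed.

End Chains.

Theorem theorem1p16 (R : realType) (q : R[i]) (hq : `|q| < 1)
    (j r k : nat) (hk : (1 <= k)%N) (hjr : (j + r <= k)%N) :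
  exists S : R[i],
    has_sum (weakly_decreasing k)
      (fun s : k.-tuple nat => multisum_term q k j r s) S /\
    has_sum (admissible k j r)
      (fun f : frequency_sequence => q ^+ freq_size f) S.
Proof.
case: k hk hjr => // k _ jr.
have small := @exprn_small_complex R.
set c := (k.+1 + j - r)%N; set p := (k.+1 + r - j + 1)%N.
have v : valid k.+1 j c p := valid_start jr.
pose T := tuple_chain k.+1; pose W := freq_chain k.+1 j c p.
have W_mono M N : (M <= N)%N -> {subset W M <= W N}.
  move=> MN f /(mem_freq_chain _ _ (ltn0Sn k) jr)[fa f0].
  apply/(mem_freq_chain _ _ (ltn0Sn k) jr); split=> // i Ni.
  by rewrite f0 // (leq_trans MN).
have T_mono M N : (M <= N)%N -> {subset T M <= T N}.
  by move=> MN s; rewrite !mem_tuple_chain; apply: box_sub.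
have WE (z : R[i]) M : \sum_(f <- W M) z ^+ freq_size f = walk z k.+1 (@one_end _) M j c p 0.
  by rewrite big_map walk_paths; apply: eq_bigr => l _; rewrite freq_size_fs_of.
have [D HD] := walk_bound small (normr_ge0 q) hq v.
have W_abs M : \sum_(f <- W M) `|q ^+ freq_size f| <= D.
  by under eq_bigr => f _ do rewrite normrX; rewrite WE.
have [C HC] := multisum_norm_bound small hq jr.
(* [S] is defined from the combinatorial side; the multisum is then shown to converge to the same
   value. *)
have [S WS] := complex_chain (freq_chain_uniq k.+1 j c p) W_mono W_abs.
exists S; split; last first.
  apply: (has_sum_chain (freq_chain_uniq k.+1 j c p) W_mono) W_abs WS.
    by move=> M f /(mem_freq_chain _ _ (ltn0Sn k) jr)[].
  move=> f fa; have [M fM] := freq_bound f; exists M.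
  by apply/(mem_freq_chain _ _ (ltn0Sn k) jr).
apply: (has_sum_chain (C := C) (tuple_chain_uniq k.+1) T_mono).
- by move=> L s; rewrite mem_tuple_chain => /sorted_box.
- move=> s ss; exists (\max_(x <- s) x).+1; rewrite mem_tuple_chain.
  apply: mem_box; rewrite ?size_tuple // => x xs; rewrite ltnS.
  exact: (@leq_bigmax_seq _ _ xpredT id).
- move=> L; rewrite (@sum_tuple_chain _ _ _ (fun s => `|multisum_term q k.+1 j r s|)).
  exact: HC.
move=> e e0; have e20 : 0 < e / 2 by rewrite divr_gt0.
have [M1 H1] := bressoud_state_walk small hq v e20; have [M2 H2] := WS _ e20.
(* One [M] large enough for both estimates is fixed before the truncation level is chosen. *)
have [L0 HL] := H1 (maxn M1 M2) (leq_maxl _ _).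
exists L0 => L LL0; rewrite (@sum_tuple_chain _ _ _ (multisum_term q k.+1 j r)).
rewrite (eq_bigr _ (fun s _ => multisum_termE q s jr)) -state_sum_box //.
rewrite (splitr e) (le_trans (ler_distD (walk q k.+1 (@one_end _) (maxn M1 M2) j c p 0) _ _)) //.
by rewrite lerD ?HL // -WE H2 ?leq_maxr.
Qed.
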